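(* Let the Hopf algebra $\mathcal{H}_1$ act projectively on an associative algebra $A$ over $\mathbb{C}$, with $\delta_2'=\delta_2-\frac12\delta_1^2$ implemented by $\Omega\in A$. Define linear operators $A_m,B_m$ on $A$ by $A_{-1}=B_{-1}=0$, $A_0=B_0=1$ and, for $m\ge0$, $$A_{m+1}=S(X)A_m-m\,\Omega^0\left(Y-\tfrac{m-1}{2}\right)A_{m-1},\qquad B_{m+1}=XB_m-m\,\Omega\left(Y-\tfrac{m-1}{2}\right)B_{m-1},$$ where $\Omega$ denotes left multiplication by $\Omega$ and $\Omega^0$ denotes right multiplication by $\Omega$. For $a,b\in A$ put $$a\ast b=\sum_{n=0}^\infty\hbar^n\sum_{k=0}^n\left(\frac{A_k}{k!}(2Y+k)_{n-k}\,(a)\right)\left(\frac{B_{n-k}}{(n-k)!}(2Y+n-k)_k\,(b)\right).$$ Then the $\mathbb{C}[[\hbar]]$-bilinear extension of $\ast$ is an associative product on $A[[\hbar]]$; that is, the element $$RC=\sum_{n\ge0}\hbar^n\sum_{k=0}^n\frac{A_k}{k!}(2Y+k)_{n-k}\otimes\frac{B_{n-k}}{(n-k)!}(2Y+n-k)_k$$ defines an associative universal deformation for projective $\mathcal{H}_1$ actions.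
   Context: $(\alpha)_k=\alpha(\alpha+1)\cdots(\alpha+k-1)$, $(\alpha)_0=1$. The Hopf algebra $\mathcal{H}_1$ is the universal enveloping algebra of the Lie algebra with basis $X,Y,\delta_n$ ($n\ge1$) and brackets $[Y,X]=X$, $[X,\delta_n]=\delta_{n+1}$, $[Y,\delta_n]=n\delta_n$, $[\delta_n,\delta_m]=0$. Its coproduct is determined by $\Delta Y=Y\otimes1+1\otimes Y$, $\Delta\delta_1=\delta_1\otimes1+1\otimes\delta_1$, $\Delta X=X\otimes1+1\otimes X+\delta_1\otimes Y$; its counit kills the generators; its antipode is determined by $S(Y)=-Y$, $S(\delta_1)=-\delta_1$, $S(X)=-X+\delta_1Y$. An action of $\mathcal{H}_1$ on an algebra $A$ makes $A$ a module algebra: $h(ab)=\sum h_{(1)}(a)h_{(2)}(b)$. The action is projective if there is $\Omega\in A$ such that $\delta_2'(a)=[\Omega,a]$ for all $a\in A$, where $\delta_2'=\delta_2-\frac12\delta_1^2$, and $\delta_k(\Omega)=0$ for all $k\ge1$.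
   Formalization: The formal theorem adds the hypothesis Y(Ω)=2Ω; without it the claim fails, e.g. for A=C[t], X=δ_k=0, Y=t d/dt, Ω=1, where associativity breaks at order ħ^4 on (t,t,t²). *)

(* Defs.v *)
From HB Require Import structures.
From mathcomp Require Import all_boot all_order all_algebra.
From mathcomp Require Import boolp reals.
From mathcomp Require Import complex.

Set Implicit Arguments.
Unset Strict Implicit.
Unset Printing Implicit Defensive.

Import GRing.Theory.
Local Open Scope ring_scope.
Local Open Scope quotient_scope.

(* Associative unital algebras presented by generators and relations: formal
   terms in the generators modulo the congruence generated by the algebra axioms
   and the relations. An augmentation (a character of the presented algebra) is
   part of the data because algType requires 1 != 0. *)

Inductive aterm (K G : Type) : Type :=
| TGen of G
| TZero
| TOne
| TOpp of aterm K G
| TAdd of aterm K G & aterm K G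
| TMul of aterm K G & aterm K G
| TScale of K & aterm K G.

Arguments TGen {K G}.
Arguments TZero {K G}.
Arguments TOne {K G}.

Definition tbracket (K G : Type) (s t : aterm K G) : aterm K G :=
  TAdd (TMul s t) (TOpp (TMul t s)).

Fixpoint aeval (K : fieldType) (G : Type) (B : algType K) (f : G -> B)
    (t : aterm K G) : B :=
  match t with
  | TGen g => f g
  | TZero => 0
  | TOne => 1
  | TOpp s => - aeval f s
  | TAdd s u => aeval f s + aeval f u
  | TMul s u => aeval f s * aeval f u
  | TScale c s => c *: aeval f s
  end.

Section Congruence.
Variables (K : fieldType) (G : Type) (rel : aterm K G -> aterm K G -> Prop).

Inductive acongr : aterm K G -> aterm K G -> Prop :=
| cong_rel s t : rel s t -> acongr s t
| cong_refl s : acongr s s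
| cong_sym s t : acongr s t -> acongr t s
| cong_trans s t u : acongr s t -> acongr t u -> acongr s u
| cong_opp s s' : acongr s s' -> acongr (TOpp s) (TOpp s')
| cong_add s s' t t' : acongr s s' -> acongr t t' ->
    acongr (TAdd s t) (TAdd s' t')
| cong_mul s s' t t' : acongr s s' -> acongr t t' ->
    acongr (TMul s t) (TMul s' t')
| cong_scale c s s' : acongr s s' -> acongr (TScale c s) (TScale c s')
| cong_addA s t u : acongr (TAdd s (TAdd t u)) (TAdd (TAdd s t) u)
| cong_addC s t : acongr (TAdd s t) (TAdd t s)
| cong_add0 s : acongr (TAdd TZero s) s
| cong_addN s : acongr (TAdd (TOpp s) s) TZero
| cong_mulA s t u : acongr (TMul s (TMul t u)) (TMul (TMul s t) u)
| cong_1mul s : acongr (TMul TOne s) s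
| cong_mul1 s : acongr (TMul s TOne) s
| cong_mulDl s t u : acongr (TMul (TAdd s t) u) (TAdd (TMul s u) (TMul t u))
| cong_mulDr s t u : acongr (TMul s (TAdd t u)) (TAdd (TMul s t) (TMul s u))
| cong_scaleA a b s : acongr (TScale a (TScale b s)) (TScale (a * b) s)
| cong_scale1 s : acongr (TScale 1 s) s
| cong_scaleDr a s t :
    acongr (TScale a (TAdd s t)) (TAdd (TScale a s) (TScale a t))
| cong_scaleDl a b s :
    acongr (TScale (a + b) s) (TAdd (TScale a s) (TScale b s))
| cong_scaleAl a s t : acongr (TScale a (TMul s t)) (TMul (TScale a s) t)
| cong_scaleAr a s t : acongr (TScale a (TMul s t)) (TMul s (TScale a t)).

Lemma aeval_congr (B : algType K) (f : G -> B) :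
  (forall s t, rel s t -> aeval f s = aeval f t) ->
  forall s t, acongr s t -> aeval f s = aeval f t.
Proof.
move=> frel s t; elim => //=.
- by move=> s1 t1 u _ -> _ ->.
- by move=> s1 s2 _ ->.
- by move=> s1 s2 t1 t2 _ -> _ ->.
- by move=> s1 s2 t1 t2 _ -> _ ->.
- by move=> c s1 s2 _ ->.
- by move=> *; rewrite addrA.
- by move=> *; rewrite addrC.
- by move=> *; rewrite add0r.
- by move=> *; rewrite addNr.
- by move=> *; rewrite mulrA.
- by move=> *; rewrite mul1r.
- by move=> *; rewrite mulr1.
- by move=> *; rewrite mulrDl.
- by move=> *; rewrite mulrDr.
- by move=> *; rewrite scalerA.
- by move=> *; rewrite scale1r.
- by move=> *; rewrite scalerDr.
- by move=> *; rewrite scalerDl.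
- by move=> *; rewrite scalerAl.
- by move=> *; rewrite scalerAr.
Qed.

End Congruence.

Record presentation (K : fieldType) : Type := Presentation {
  pgen : Type;
  prel : aterm K pgen -> aterm K pgen -> Prop;
  paug : pgen -> K^o;
  paugP : forall s t, prel s t -> aeval paug s = aeval paug t }.

Section PresentedAlgebra.
Variables (K : fieldType) (P : presentation K).
Local Notation term := (aterm K (pgen P)).

HB.instance Definition _ := gen_eqMixin (aterm K (pgen P)).
HB.instance Definition _ := gen_choiceMixin (aterm K (pgen P)).

Definition acongrb (s t : term) : bool := `[< acongr (@prel K P) s t >].

Lemma acongrb_refl : reflexive acongrb.
Proof. by move=> s; apply/asboolP; apply: cong_refl. Qed.

Lemma acongrb_sym : symmetric acongrb.
Proof.
by move=> s t; apply/asboolP/asboolP; apply: cong_sym.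
Qed.

Lemma acongrb_trans : transitive acongrb.
Proof.
move=> t s u /asboolP st /asboolP tu; apply/asboolP.
exact: cong_trans st tu.
Qed.

Canonical acongr_equiv :=
  EquivRel acongrb acongrb_refl acongrb_sym acongrb_trans.

Definition palg : Type := {eq_quot acongr_equiv}.
HB.instance Definition _ := Choice.on palg.
HB.instance Definition _ := Quotient.on palg.
HB.instance Definition _ := EqQuotient.on palg.

Definition pclass (t : term) : palg := \pi_palg t.

Lemma pclassP s t : acongr (@prel K P) s t <-> pclass s = pclass t.
Proof.
split=> [st|/eqP]; first by apply/eqP; rewrite /pclass eqmodE; apply/asboolP.
by rewrite /pclass eqmodE => /asboolP.
Qed.

Definition prepr (x : palg) : term := repr x.

Lemma preprK x : pclass (prepr x) = x.
Proof. exact: reprK. Qed.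

Definition pzero := pclass TZero.
Definition pone := pclass TOne.
Definition popp x := pclass (TOpp (prepr x)).
Definition padd x y := pclass (TAdd (prepr x) (prepr y)).
Definition pmul x y := pclass (TMul (prepr x) (prepr y)).
Definition pscale c x := pclass (TScale c (prepr x)).

Lemma repr_class t : acongr (@prel K P) (prepr (pclass t)) t.
Proof. by apply/pclassP; rewrite preprK. Qed.

Lemma poppE s : popp (pclass s) = pclass (TOpp s).
Proof. by apply/pclassP; apply: cong_opp; apply: repr_class. Qed.

Lemma paddE s t : padd (pclass s) (pclass t) = pclass (TAdd s t).
Proof. by apply/pclassP; apply: cong_add; apply: repr_class. Qed.

Lemma pmulE s t : pmul (pclass s) (pclass t) = pclass (TMul s t).
Proof. by apply/pclassP; apply: cong_mul; apply: repr_class. Qed.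

Lemma pscaleE c s : pscale c (pclass s) = pclass (TScale c s).
Proof. by apply/pclassP; apply: cong_scale; apply: repr_class. Qed.

Definition popsE := (poppE, paddE, pmulE, pscaleE).

Lemma palgW (Q : palg -> Prop) : (forall t, Q (pclass t)) -> forall x, Q x.
Proof. by move=> Qt x; rewrite -[x]preprK. Qed.

Lemma paddA : associative padd.
Proof.
by do 3 elim/palgW => ?; rewrite !popsE; apply/pclassP; constructor.
Qed.

Lemma paddC : commutative padd.
Proof.
by do 2 elim/palgW => ?; rewrite !popsE; apply/pclassP; apply: cong_addC.
Qed.

Lemma padd0 : left_id pzero padd.
Proof. by elim/palgW => ?; rewrite !popsE; apply/pclassP; constructor. Qed.

Lemma paddN : left_inverse pzero popp padd.
Proof. by elim/palgW => ?; rewrite !popsE; apply/pclassP; constructor. Qed.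

Lemma pmulA : associative pmul.
Proof.
by do 3 elim/palgW => ?; rewrite !popsE; apply/pclassP; constructor.
Qed.

Lemma pmul1l : left_id pone pmul.
Proof. by elim/palgW => ?; rewrite !popsE; apply/pclassP; constructor. Qed.

Lemma pmul1r : right_id pone pmul.
Proof. by elim/palgW => ?; rewrite !popsE; apply/pclassP; constructor. Qed.

Lemma pmulDl : left_distributive pmul padd.
Proof.
by do 3 elim/palgW => ?; rewrite !popsE; apply/pclassP; constructor.
Qed.

Lemma pmulDr : right_distributive pmul padd.
Proof.
by do 3 elim/palgW => ?; rewrite !popsE; apply/pclassP; constructor.
Qed.

Lemma pone_neq0 : pone != pzero.
Proof.
apply/eqP => /pclassP /(aeval_congr (@paugP K P)) /= /eqP.
by rewrite oner_eq0.
Qed.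

HB.instance Definition _ := GRing.isNzRing.Build palg
  paddA paddC padd0 paddN pmulA pmul1l pmul1r pmulDl pmulDr pone_neq0.

Lemma pscaleA a b x : pscale a (pscale b x) = pscale (a * b) x.
Proof.
by elim/palgW: x => x; rewrite !popsE; apply/pclassP; constructor.
Qed.

Lemma pscale1 : left_id 1 pscale.
Proof. by elim/palgW => x; rewrite !popsE; apply/pclassP; constructor. Qed.

Lemma pscaleDr : right_distributive pscale +%R.
Proof.
move=> a; do 2 elim/palgW => ?; rewrite /+%R /= !popsE; apply/pclassP.
by constructor.
Qed.

Lemma pscaleDl x : {morph pscale^~ x : a b / a + b}.
Proof.
elim/palgW: x => x a b; rewrite [RHS]/+%R /= !popsE; apply/pclassP.
by constructor.
Qed.

HB.instance Definition _ := GRing.Zmodule_isLmodule.Build K palg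
  pscaleA pscale1 pscaleDr pscaleDl.

Lemma pscaleAl a (x y : palg) : a *: (x * y) = a *: x * y.
Proof.
move: x y; do 2 elim/palgW => ?; rewrite /*%R /*:%R /= !popsE.
by apply/pclassP; constructor.
Qed.

Lemma pscaleAr a (x y : palg) : a *: (x * y) = x * (a *: y).
Proof.
move: x y; do 2 elim/palgW => ?; rewrite /*%R /*:%R /= !popsE.
by apply/pclassP; constructor.
Qed.

HB.instance Definition _ := GRing.Lmodule_isLalgebra.Build K palg pscaleAl.
HB.instance Definition _ := GRing.Lalgebra_isAlgebra.Build K palg pscaleAr.

Definition pg (g : pgen P) : palg := pclass (TGen g).

Lemma pclass_eval t : pclass t = aeval pg t.
Proof.
elim: t => //=.
- by move=> s <-; rewrite /-%R /= popsE.
- by move=> s <- t <-; rewrite /+%R /= popsE.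
- by move=> s <- t <-; rewrite /*%R /= popsE.
- by move=> c s <-; rewrite /*:%R /= popsE.
Qed.

Lemma prelE s t : prel s t -> aeval pg s = aeval pg t.
Proof.
by move=> st; rewrite -!pclass_eval; apply/pclassP; apply: cong_rel.
Qed.

Section Lift.
Variables (B : algType K) (f : pgen P -> B).
Hypothesis frel : forall s t, prel s t -> aeval f s = aeval f t.

Definition plift_of (_ : forall s t, prel s t -> aeval f s = aeval f t)
  (x : palg) : B := aeval f (prepr x).

Local Notation plift := (plift_of frel).

Lemma plift_class t : plift (pclass t) = aeval f t.
Proof. by apply: (aeval_congr frel); apply: repr_class. Qed.

Lemma plift_gen g : plift (pg g) = f g.
Proof. exact: plift_class. Qed.

Lemma plift_linear : linear plift.
Proof.
move=> c x y; elim/palgW: x => x; elim/palgW: y => y.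
have -> : c *: pclass x + pclass y = pclass (TAdd (TScale c x) y).
  by rewrite /+%R /*:%R /= !popsE.
by rewrite !plift_class.
Qed.

Lemma plift_monoid : monoid_morphism plift.
Proof.
split; first exact: plift_class.
move=> x y; elim/palgW: x => x; elim/palgW: y => y.
by rewrite [X in plift X]/*%R /= popsE !plift_class.
Qed.

HB.instance Definition _ := GRing.isLinear.Build K palg B _ plift plift_linear.
HB.instance Definition _ := GRing.isMonoidMorphism.Build palg B plift plift_monoid.

End Lift.
End PresentedAlgebra.

Arguments pg {K} P g.

Definition plift (K : fieldType) (P : presentation K) (B : algType K)
    (f : pgen P -> B)
    (frel : forall s t, prel s t -> aeval f s = aeval f t) :
    {lrmorphism palg P -> B} := plift_of frel.

(* The augmentation character of a presented algebra. *)
Definition peps (K : fieldType) (P : presentation K) :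
  {lrmorphism palg P -> K^o} := plift (@paugP K P).

(* The opposite algebra, as an algebra over the same field. *)
Section ConverseAlgebra.
Variables (K : fieldType) (B : algType K).

HB.instance Definition _ := GRing.Lmodule.on B^c.

Lemma conv_scaleAl (a : K) (u v : B^c) :
  a *: (u * v) = (a *: u : B^c) * v.
Proof. exact: (@scalerAr K B a v u). Qed.

Lemma conv_scaleAr (a : K) (u v : B^c) :
  a *: (u * v) = u * (a *: v : B^c).
Proof. exact: (@scalerAl K B a v u). Qed.

HB.instance Definition _ := GRing.Lmodule_isLalgebra.Build K B^c conv_scaleAl.
HB.instance Definition _ := GRing.Lalgebra_isAlgebra.Build K B^c conv_scaleAr.
End ConverseAlgebra.

(* Tensor product of two (augmented) algebras: generated by the pure tensors
   u (x) v, subject to bilinearity and to the componentwise multiplication. *)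
Section TensorProduct.
Variables (K : fieldType) (P Q : presentation K).
Local Notation g u v := (TGen (u, v)).

Inductive tens_rel : aterm K (palg P * palg Q) -> aterm K (palg P * palg Q) ->
    Prop :=
| tens_addl u u' v : tens_rel (g (u + u') v) (TAdd (g u v) (g u' v))
| tens_addr u v v' : tens_rel (g u (v + v')) (TAdd (g u v) (g u v'))
| tens_scalel c u v : tens_rel (g (c *: u) v) (TScale c (g u v))
| tens_scaler c u v : tens_rel (g u (c *: v)) (TScale c (g u v))
| tens_one : tens_rel (g 1 1) TOne
| tens_mul u u' v v' : tens_rel (TMul (g u v) (g u' v')) (g (u * u') (v * v')).

Definition tens_aug (p : palg P * palg Q) : K^o := peps P p.1 * peps Q p.2.

Lemma tens_augP s t : tens_rel s t -> aeval tens_aug s = aeval tens_aug t.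
Proof.
have eE p : aeval tens_aug (TGen p) = peps P p.1 * peps Q p.2 by [].
case=> [u u' v|u v v'|c u v|c u v||u u' v v'];
  rewrite -?[aeval _ (TAdd _ _)]/(aeval _ _ + aeval _ _)
    -?[aeval _ (TScale _ _)]/(_ *: aeval _ _)
    -?[aeval _ (TMul _ _)]/(aeval _ _ * aeval _ _) !eE ![fst _]/= ![snd _]/=.
- by rewrite linearD mulrDl.
- by rewrite linearD mulrDr.
- by rewrite linearZ; apply: esym; exact: mulrA.
- by rewrite linearZ; exact: mulrCA.
- by rewrite !rmorph1 mulr1.
- by rewrite !rmorphM mulrACA.
Qed.

Definition tens_pres : presentation K := Presentation tens_augP.
Definition tensalg : Type := palg tens_pres.
HB.instance Definition _ := GRing.Algebra.on tensalg.

Definition tens (u : palg P) (v : palg Q) : tensalg := pg tens_pres (u, v).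

Lemma tensDl u u' v : tens (u + u') v = tens u v + tens u' v.
Proof. exact: (@prelE K tens_pres _ _ (tens_addl u u' v)). Qed.

Lemma tensDr u v v' : tens u (v + v') = tens u v + tens u v'.
Proof. exact: (@prelE K tens_pres _ _ (tens_addr u v v')). Qed.

Lemma tensZl c u v : tens (c *: u) v = c *: tens u v.
Proof. exact: (@prelE K tens_pres _ _ (tens_scalel c u v)). Qed.

Lemma tensZr c u v : tens u (c *: v) = c *: tens u v.
Proof. exact: (@prelE K tens_pres _ _ (tens_scaler c u v)). Qed.

Lemma tens11 : tens 1 1 = 1.
Proof. exact: (@prelE K tens_pres _ _ tens_one). Qed.

Lemma tensM u u' v v' : tens u v * tens u' v' = tens (u * u') (v * v').
Proof. exact: (@prelE K tens_pres _ _ (tens_mul u u' v v')). Qed.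

Lemma tensBl u u' v : tens (u - u') v = tens u v - tens u' v.
Proof. by rewrite -!scaleN1r tensDl tensZl. Qed.

Lemma tensBr u v v' : tens u (v - v') = tens u v - tens u v'.
Proof. by rewrite -!scaleN1r tensDr tensZr. Qed.

Lemma tens0l v : tens 0 v = 0.
Proof. by rewrite -(scale0r (0 : palg P)) tensZl scale0r. Qed.

Lemma tens0r u : tens u 0 = 0.
Proof. by rewrite -(scale0r (0 : palg Q)) tensZr scale0r. Qed.

End TensorProduct.

Definition lie (B : pzRingType) (a b : B) : B := a * b - b * a.

(* The algebra H_1, i.e. the enveloping algebra of the Lie algebra with basis
   X, Y, delta_1, delta_2, ..., presented by this basis and its brackets.
   The generator GD n stands for delta_(n+1). *)
Inductive H1gen : Type := GX | GY | GD of nat.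

Section H1.
Variable K : fieldType.
Local Notation D n := (TGen (GD n)).

Inductive H1_rel : aterm K H1gen -> aterm K H1gen -> Prop :=
| H1_YX : H1_rel (tbracket (TGen GY) (TGen GX)) (TGen GX)
| H1_XD n : H1_rel (tbracket (TGen GX) (D n)) (D n.+1)
| H1_YD n : H1_rel (tbracket (TGen GY) (D n)) (TScale n.+1%:R (D n))
| H1_DD n m : H1_rel (tbracket (D n) (D m)) TZero.

Lemma H1_augP s t : H1_rel s t ->
  aeval (fun=> 0 : K^o) s = aeval (fun=> 0) t.
Proof. by case=> *; rewrite /= mul0r ?scaler0 subr0. Qed.

Definition H1_pres : presentation K := Presentation H1_augP.
Definition H1 : Type := palg H1_pres.
HB.instance Definition _ := GRing.Algebra.on H1.

Definition hX : H1 := pg H1_pres GX.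
Definition hY : H1 := pg H1_pres GY.

(* hdelta k is delta_k for k >= 1; the value at k = 0 is irrelevant. *)
Definition hdelta (k : nat) : H1 := if k is n.+1 then pg H1_pres (GD n) else 0.

Lemma hYX : lie hY hX = hX.
Proof. exact: (@prelE K H1_pres _ _ (H1_YX)). Qed.

Lemma hXdelta n : lie hX (hdelta n.+1) = hdelta n.+2.
Proof. exact: (@prelE K H1_pres _ _ (H1_XD n)). Qed.

Lemma hYdelta n : lie hY (hdelta n.+1) = n.+1%:R *: hdelta n.+1.
Proof. exact: (@prelE K H1_pres _ _ (H1_YD n)). Qed.

Lemma hdeltaC n m : lie (hdelta n.+1) (hdelta m.+1) = 0.
Proof. exact: (@prelE K H1_pres _ _ (H1_DD n m)). Qed.

End H1.

Lemma zmod_subACA (V : zmodType) (p q r s : V) :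
  p - q - (r - s) = p - r - (q - s).
Proof. by rewrite [in LHS]opprD [in RHS]opprD addrACA. Qed.

Lemma zmod_jacobi (V : zmodType) (p q m m' k k' : V) :
  p + k + m - (k' + (q + m')) - (m - m') = k - k' + (p - q).
Proof.
rewrite addrAC opprB [m' - m]addrC addrA addrK [k' + _]addrA opprD.
by rewrite addrACA subrr addr0 opprD [p + k]addrC addrACA.
Qed.

(* Algebra maps out of H_1 are determined by the images x, y, d of X, Y and
   delta_1, since delta_(n+1) = [X, delta_n]. *)
Section H1Morphisms.
Variables (K : fieldType) (B : algType K) (x y d : B).

Definition H1_img (g : H1gen) : B :=
  match g with
  | GX => x
  | GY => y
  | GD n => iter n (lie x) d
  end.

Inductive subalg_gen (S : B -> Prop) : B -> Prop :=
| sgen u : S u -> subalg_gen S u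
| sgen_sub u v : subalg_gen S u -> subalg_gen S v -> subalg_gen S (u - v)
| sgen_add u v : subalg_gen S u -> subalg_gen S v -> subalg_gen S (u + v)
| sgen_mul u v : subalg_gen S u -> subalg_gen S v -> subalg_gen S (u * v)
| sgen_scale c u : subalg_gen S u -> subalg_gen S (c *: u).

Lemma sgen_commute (S : B -> Prop) u v :
  (forall a b, S a -> S b -> a * b = b * a) ->
  subalg_gen S u -> subalg_gen S v -> u * v = v * u.
Proof.
move=> SC Su; elim=> {v} [b Sb|a b _ Ha _ Hb|a b _ Ha _ Hb|a b _ Ha _ Hb|c a _ Ha].
- elim: Su => {u} [a Sa|a c _ Ha _ Hc|a c _ Ha _ Hc|a c _ Ha _ Hc|c a _ Ha].
  + exact: SC.
  + by rewrite mulrBl mulrBr Ha Hc.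
  + by rewrite mulrDl mulrDr Ha Hc.
  + by rewrite -mulrA Hc mulrA Ha mulrA.
  + by rewrite -scalerAl -scalerAr Ha.
- by rewrite mulrBl mulrBr Ha Hb.
- by rewrite mulrDl mulrDr Ha Hb.
- by rewrite mulrA Ha -mulrA Hb mulrA.
- by rewrite -scalerAl -scalerAr Ha.
Qed.

Lemma sgen_ad (S : B -> Prop) z :
  (forall a, S a -> subalg_gen S (lie x a)) ->
  subalg_gen S z -> subalg_gen S (lie x z).
Proof.
rewrite /lie => Sx; elim=> {z} [z|u v Su Hu Sv Hv|u v Su Hu Sv Hv|u v Su Hu Sv Hv|c u Su Hu].
- exact: Sx.
- have -> : x * (u - v) - (u - v) * x = (x * u - u * x) - (x * v - v * x).
    by rewrite mulrBr mulrBl; apply: zmod_subACA.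
  exact: sgen_sub.
- by rewrite mulrDr mulrDl opprD addrACA; apply: sgen_add.
- have -> : x * (u * v) - u * v * x
    = (x * u - u * x) * v + u * (x * v - v * x).
    by rewrite mulrBl mulrBr !mulrA addrA subrK.
  by apply: sgen_add; apply: sgen_mul.
- by rewrite -scalerAl -scalerAr -scalerBr; apply: sgen_scale.
Qed.

Hypothesis yx : lie y x = x.
Hypothesis yd : lie y d = d.
Variable S : B -> Prop.
Hypothesis SC : forall a b, S a -> S b -> a * b = b * a.
Hypothesis Sx : forall a, S a -> subalg_gen S (lie x a).
Hypothesis Sd : subalg_gen S d.

Lemma H1_img_rel s t : H1_rel s t -> aeval H1_img s = aeval H1_img t.
Proof.
have Sn n : subalg_gen S (iter n (lie x) d).
  by elim: n => [|n IHn] //=; apply: sgen_ad.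
case=> [|n|n|n m] //=; last first.
  by rewrite (sgen_commute SC (Sn m) (Sn n)) subrr.
elim: n => [|n IHn]; first by rewrite scale1r.
rewrite iterS; move: (iter n _ d) IHn => z zE.
have yxE : y * x = x + x * y by rewrite -[X in X + _]yx /lie subrK.
have yzE : y * z = n.+1%:R *: z + z * y by rewrite -zE subrK.
have e1 : y * (x * z) = x * z + n.+1%:R *: (x * z) + x * z * y.
  by rewrite mulrA yxE mulrDl -!mulrA yzE mulrDr -scalerAr addrA.
have e2 : y * (z * x) = n.+1%:R *: (z * x) + (z * x + z * x * y).
  by rewrite mulrA yzE mulrDl -!mulrA yxE mulrDr -scalerAl.
rewrite /lie mulrBr mulrBl e1 e2 -[n.+2%:R]natr1 scalerDl scale1r scalerBr.
exact: zmod_jacobi.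
Qed.

End H1Morphisms.

Section Hopf.
Variable K : fieldType.
Local Notation H := (H1 K).
Local Notation HH := (tensalg (H1_pres K) (H1_pres K)).
Local Notation X := (hX K).
Local Notation Y := (hY K).
Local Notation delta := (hdelta K).

Local Notation "u '(x)' v" := (tens (u : palg (H1_pres K)) (v : palg (H1_pres K)) : HH)
  (at level 40).

Definition DeltaX : HH := X (x) 1 + 1 (x) X + delta 1 (x) Y.
Definition DeltaY : HH := Y (x) 1 + 1 (x) Y.
Definition Deltad : HH := delta 1 (x) 1 + 1 (x) delta 1.

Definition Delta_img : H1gen -> HH := H1_img DeltaX DeltaY Deltad.

Let SD (z : HH) : Prop :=
  exists n, z = delta n.+1 (x) 1 \/ z = 1 (x) delta n.+1.

Let lieDl (B : pzRingType) (a b c : B) : lie (a + b) c = lie a c + lie b c.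
Proof. by rewrite /lie mulrDl mulrDr opprD addrACA. Qed.

Let lieDr (B : pzRingType) (a b c : B) : lie a (b + c) = lie a b + lie a c.
Proof. by rewrite /lie mulrDl mulrDr opprD addrACA. Qed.

Let lieC (B : pzRingType) (a b : B) : lie a b = - lie b a.
Proof. by rewrite /lie opprB. Qed.

Let lieNl (B : pzRingType) (a b : B) : lie (- a) b = - lie a b.
Proof. by rewrite /lie mulrN mulNr opprD. Qed.

Let lieNr (B : pzRingType) (a b : B) : lie a (- b) = - lie a b.
Proof. by rewrite /lie mulrN mulNr opprD. Qed.

Let lieMr (B : pzRingType) (a b c : B) :
  lie a (b * c) = lie a b * c + b * lie a c.
Proof. by rewrite /lie mulrBl mulrBr !mulrA addrA subrK. Qed.

Let lie_tl (u u' v : palg (H1_pres K)) :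
  lie (u (x) v) (u' (x) 1) = lie u u' (x) v.
Proof. by rewrite /lie !tensM mulr1 mul1r tensBl. Qed.

Let lie_tr (u v v' : palg (H1_pres K)) :
  lie (u (x) v) (1 (x) v') = u (x) lie v v'.
Proof. by rewrite /lie !tensM mulr1 mul1r tensBr. Qed.

Let lie_lt (u u' v : palg (H1_pres K)) :
  lie (u' (x) 1) (u (x) v) = lie u' u (x) v.
Proof. by rewrite /lie !tensM mulr1 mul1r tensBl. Qed.

Let lie_rt (u v v' : palg (H1_pres K)) :
  lie (1 (x) v') (u (x) v) = u (x) lie v' v.
Proof. by rewrite /lie !tensM mulr1 mul1r tensBr. Qed.

Let lie1r (B : pzRingType) (a : B) : lie a 1 = 0.
Proof. by rewrite /lie mulr1 mul1r subrr. Qed.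

Let lie1l (B : pzRingType) (a : B) : lie 1 a = 0.
Proof. by rewrite /lie mulr1 mul1r subrr. Qed.

Let lie_aa (B : pzRingType) (a : B) : lie a a = 0.
Proof. by rewrite /lie subrr. Qed.

Let hYd1 : lie Y (delta 1) = delta 1.
Proof. by rewrite hYdelta scale1r. Qed.

Lemma Delta_rel s t : @H1_rel K s t -> aeval Delta_img s = aeval Delta_img t.
Proof.
apply: (@H1_img_rel _ _ _ _ _ _ _ SD).
- rewrite /DeltaX /DeltaY !(lieDl, lieDr) !lie_lt !lie_rt.
  rewrite hYX !lie1r lie_aa hYd1 !tens0l !tens0r.
  by rewrite !addr0 !add0r addrAC.
- rewrite /Deltad /DeltaY !(lieDl, lieDr) !lie_lt !lie_rt.
  by rewrite !lie1r hYd1 !tens0l !tens0r !addr0 !add0r.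
- move=> a b [n [->|->]] [m [->|->]]; apply: subr0_eq;
    rewrite -[LHS]/(lie _ _) ?lie_lt ?lie_rt ?lie1r ?hdeltaC;
    by rewrite ?tens0l ?tens0r.
- move=> a [n [->|->]]; rewrite /DeltaX !lieDl.
  + rewrite lie_lt lie_rt lie_tl lie1r hXdelta hdeltaC tens0l tens0r !addr0.
    by apply: sgen; exists n.+1; left.
  + rewrite lie_lt lie_rt lie_tr lie1r hXdelta hYdelta tens0l add0r tensZr.
    apply: sgen_add; first by apply: sgen; exists n.+1; right.
    apply: sgen_scale; rewrite -[delta 1]mulr1 -[delta n.+1]mul1r -tensM.
    by apply: sgen_mul; apply: sgen; [exists 0%N; left|exists n; right].
- by apply: sgen_add; apply: sgen; exists 0%N; [left|right].
Qed.

Definition coproduct : {lrmorphism H -> HH} :=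
  plift (P := H1_pres K) Delta_rel.

Lemma coproductX : coproduct X = X (x) 1 + 1 (x) X + delta 1 (x) Y.
Proof. exact: (plift_gen (P := H1_pres K) Delta_rel GX). Qed.

Lemma coproductY : coproduct Y = Y (x) 1 + 1 (x) Y.
Proof. exact: (plift_gen (P := H1_pres K) Delta_rel GY). Qed.

Lemma coproductd : coproduct (delta 1) = delta 1 (x) 1 + 1 (x) delta 1.
Proof. exact: (plift_gen (P := H1_pres K) Delta_rel (GD 0)). Qed.

(* The antipode, as an algebra morphism to the opposite algebra. *)
Definition S_img : H1gen -> (H : algType K)^c :=
  H1_img (- X + delta 1 * Y : H^c) (- Y : H^c) (- delta 1 : H^c).

Lemma S_rel s t : @H1_rel K s t -> aeval S_img s = aeval S_img t.
Proof.
have lie_conv (a b : H) : lie (a : H^c) b = lie b a by [].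
have hdY n : lie (delta n.+1) Y = - (n.+1%:R *: delta n.+1).
  by rewrite lieC hYdelta.
apply: (@H1_img_rel K (H : algType K)^c _ _ _ _ _
  (fun z => exists n, z = delta n.+1)).
- rewrite lie_conv lieDl lieNl !lieNr opprK lieC hYX.
  by rewrite lieC lieMr lie_aa mulr0 addr0 hYd1 opprK.
- by rewrite lie_conv lieNl lieNr opprK hdY scale1r.
- move=> a b [n ->] [m ->]; apply: subr0_eq; exact: hdeltaC.
- move=> a [n ->]; rewrite lie_conv lieDr lieNr lieC opprK hXdelta.
  rewrite lieMr hdeltaC mul0r add0r hdY mulrN.
  apply: sgen_sub; first by apply: sgen; exists n.+1.
  rewrite -scalerAr; apply: sgen_scale.
  by apply: (@sgen_mul _ H^c _ (delta n.+1) (delta 1)); apply: sgen;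
    [exists n|exists 0%N].
- by rewrite -scaleN1r; apply: sgen_scale; apply: sgen; exists 0%N.
Qed.

Definition antipode : {lrmorphism H -> (H : algType K)^c} :=
  plift (P := H1_pres K) S_rel.

Lemma antipodeM (h k : H) :
  antipode (h * k) = (antipode k : H) * (antipode h : H).
Proof. exact: (rmorphM antipode). Qed.

Lemma antipodeX : antipode X = - X + delta 1 * Y.
Proof. exact: (plift_gen (P := H1_pres K) S_rel GX). Qed.

Lemma antipodeY : antipode Y = - Y.
Proof. exact: (plift_gen (P := H1_pres K) S_rel GY). Qed.

Lemma antipoded : antipode (delta 1) = - delta 1.
Proof. exact: (plift_gen (P := H1_pres K) S_rel (GD 0)). Qed.

Definition counit : {lrmorphism H -> K^o} := peps (H1_pres K).

End Hopf.

(* H_1-module algebra structure on a vector space A with a bilinear product mul,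
   which need not be unital. The Sweedler sum h_(1) (x) h_(2) is any finite sum
   of pure tensors equal to the coproduct of h. *)
Record H1_action (K : fieldType) (A : lmodType K)
    (mul : {bilinear A -> A -> A}) (act : {bilinear H1 K -> A -> A}) : Prop := {
  action1 : forall a, act 1 a = a;
  actionM : forall h k a, act (h * k) a = act h (act k a);
  action_mul : forall h (s : seq (H1 K * H1 K)),
    coproduct K h = \sum_(p <- s) tens p.1 p.2 ->
    forall a b, act h (mul a b) = \sum_(p <- s) mul (act p.1 a) (act p.2 b) }.

Definition hdelta2' (K : fieldType) : H1 K :=
  hdelta K 2 - 2%:R^-1 *: hdelta K 1 ^+ 2.

(* Projectivity determines the weight of Omega only modulo the centre of A:
   Y(Omega) = 2 Omega does not follow from it. *)
Record H1_projective (K : fieldType) (A : lmodType K)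
    (mul : {bilinear A -> A -> A}) (act : {bilinear H1 K -> A -> A})
    (Omega : A) : Prop := {
  proj_action : H1_action mul act;
  proj_delta2' : forall a, act (hdelta2' K) a = mul Omega a - mul a Omega;
  proj_deltaO : forall k, (1 <= k)%N -> act (hdelta K k) Omega = 0 }.

(* (x)_k = x (x + 1) ... (x + k - 1) *)
Definition poch (B : pzRingType) (x : B) (k : nat) : B :=
  \prod_(i < k) (x + i%:R).

Section RankinCohen.
Variables (K : fieldType) (A : lmodType K).
Variables (mul : {bilinear A -> A -> A}) (act : {bilinear H1 K -> A -> A}).
Variable Omega : A.

(* The pair (T_m, T_(m-1)) for the sequence of operators given by T_(-1) = 0,
   T_0 = 1 and T_(m+1) = Z T_m - m W (Y - (m-1)/2) T_(m-1). *)
Fixpoint rc_rec (Z W : A -> A) (m : nat) : (A -> A) * (A -> A) :=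
  if m is n.+1 then
    let T := rc_rec Z W n in
    (fun a => Z (T.1 a)
       - n%:R *: W (act (hY K - ((n%:R - 1) / 2%:R) *: 1) (T.2 a)), T.1)
  else (fun a => a, fun=> 0).

Definition opA (m : nat) : A -> A :=
  (rc_rec (act (antipode K (hX K))) (fun a => mul a Omega) m).1.

Definition opB (m : nat) : A -> A :=
  (rc_rec (act (hX K)) (fun a => mul Omega a) m).1.

(* The coefficient of hbar^n in a * b. *)
Definition rc_bracket (n : nat) (a b : A) : A :=
  \sum_(k < n.+1)
    mul ((k`!)%:R^-1 *: opA k (act (poch (2%:R * hY K + k%:R) (n - k)) a))
        (((n - k)`!)%:R^-1 *:
           opB (n - k) (act (poch (2%:R * hY K + (n - k)%:R) k) b)).

(* K[[hbar]] and A[[hbar]] are the types nat -> K and nat -> A of sequences of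
   coefficients. *)
Definition hconst (a : A) : nat -> A := fun n => if n == 0%N then a else 0.

Definition hadd (f g : nat -> A) : nat -> A := fun n => f n + g n.

Definition hscale (c : nat -> K) (f : nat -> A) : nat -> A :=
  fun n => \sum_(i < n.+1) c i *: f (n - i)%N.

Definition hbilinear (star : (nat -> A) -> (nat -> A) -> nat -> A) : Prop :=
  [/\ forall f f' g, star (hadd f f') g = hadd (star f g) (star f' g),
      forall f g g', star f (hadd g g') = hadd (star f g) (star f g'),
      forall c f g, star (hscale c f) g = hscale c (star f g) &
      forall c f g, star f (hscale c g) = hscale c (star f g)].

Definition rc_series (a b : A) : nat -> A := fun n => rc_bracket n a b.

Definition rc_star (f g : nat -> A) : nat -> A := fun n =>
  \sum_(i < n.+1) \sum_(j < n.+1 | (i + j <= n)%N)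
    rc_bracket (n - (i + j)) (f i) (g j).

End RankinCohen.

(* Main.v *)
Require Import Defs.
From HB Require Import structures.
From mathcomp Require Import all_boot all_order all_algebra.
From mathcomp Require Import boolp reals.
From mathcomp Require Import complex.
From mathcomp Require Import ssrcomplements mpoly ring.

Set Implicit Arguments.
Unset Strict Implicit.
Unset Printing Implicit Defensive.

Import GRing.Theory.
Local Open Scope ring_scope.

(* The product is a Moyal product in disguise. An element [a] is viewed as a
   homogeneous function on the punctured plane, and its jet at the base point
   (0, 1) as a linear functional on K[xi, eta], sending xi^k eta^l to
   B_k (2Y+k)_l a for the left structure and to (-1)^k A_k (2Y+k)_l a for the
   right one. A third variable records the powers of delta_1/2, which acts on
   the plane by a shear fixing the base point. This shear turns right jets into
   left ones, so n! times the n-th bracket of [a] and [b] is the value of the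
   n-th power of the symplectic form on the jets of [a] and of the sheared [b].
   A left jet is determined by its value at 1 and by how X and Y act on it;
   as the symplectic form is annihilated by sl_2, this gives the jet of a
   bracket in terms of those of its arguments. Associativity then amounts to an
   identity between the sums of the symplectic forms of the three pairs of
   factors of a triple product. *)

(** * Linear identities in modules *)

Section ModuleReflection.
Variables (K : comPzRingType) (A : lmodType K).

Inductive lexpr : Type :=
| LAtom of nat
| LZero
| LOpp of lexpr
| LAdd of lexpr & lexpr
| LScale of K & lexpr
| LNat of lexpr & nat.

Fixpoint leval (env : seq A) (e : lexpr) : A :=
  match e with
  | LAtom i => env`_i
  | LZero => 0
  | LOpp f => - leval env f
  | LAdd f g => leval env f + leval env g
  | LScale c f => c *: leval env f
  | LNat f n => leval env f *+ n
  end.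

Fixpoint lcoef (e : lexpr) (i : nat) : K :=
  match e with
  | LAtom j => if eqn i j then 1 else 0
  | LZero => 0
  | LOpp f => - lcoef f i
  | LAdd f g => lcoef f i + lcoef g i
  | LScale c f => c * lcoef f i
  | LNat f n => lcoef f i * n%:R
  end.

Lemma levalE env e : leval env e = \sum_(i < size env) lcoef e i *: env`_i.
Proof.
elim: e => /= [j||f ->|f -> g ->|c f ->|f -> n].
- rewrite eqnE; have [lt_j|le_j] := ltnP j (size env); last first.
    rewrite nth_default // big1 // => i _.
    by rewrite ltn_eqF ?scale0r // (leq_trans (ltn_ord i)).
  rewrite (bigD1 (Ordinal lt_j)) //= eqxx scale1r big1 ?addr0 // => i ne.
  by rewrite -val_eqE /= in ne; rewrite (negbTE ne) scale0r.
- by rewrite big1 // => i _; rewrite scale0r.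
- by rewrite -sumrN; apply: eq_bigr => i _; rewrite scaleNr.
- by rewrite -big_split; apply: eq_bigr => i _; rewrite scalerDl.
- by rewrite scaler_sumr; apply: eq_bigr => i _; rewrite scalerA.
- by rewrite -sumrMnl; apply: eq_bigr => i _; rewrite mulr_natr scalerMnl.
Qed.

(** Recursion instead of a quantifier: on an explicit list of atoms this reduces to a conjunction,
    one scalar goal per atom for [ring]. *)
Fixpoint lall (n : nat) (Q : nat -> Prop) : Prop :=
  if n is m.+1 then Q m /\ lall m Q else True.

Lemma leval_eq env e f :
  lall (size env) (fun i => lcoef e i = lcoef f i) ->
  leval env e = leval env f.
Proof.
move=> ef; rewrite !levalE; apply: eq_bigr => i _; congr (_ *: _).
elim: (size env) i ef => [[]//|n IHn] i [efn efs].
have [lt_in|le_ni] := ltnP i n; first exact: (IHn (Ordinal lt_in)).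
by have -> : i = n :> nat by apply/eqP; rewrite eqn_leq le_ni -ltnS ltn_ord.
Qed.

End ModuleReflection.

Ltac lindex_syn a env :=
  lazymatch env with
  | ?b :: ?env' =>
    match a with
    | b => constr:(0%N)
    | _ => let i := lindex_syn a env' in constr:(S i)
    end
  end.

Ltac lindex_conv a env :=
  lazymatch env with
  | ?b :: ?env' =>
    match goal with
    | _ => let _ := match goal with _ => unify a b end in constr:(0%N)
    | _ => let i := lindex_conv a env' in constr:(S i)
    end
  end.

(* Atoms may differ by the canonical instances they mention, hence the second
   lookup, up to conversion. *)
Ltac lindex a env :=
  match goal with
  | _ => lindex_syn a env
  | _ => lindex_conv a env
  end.

Ltac lenv env a :=
  lazymatch a with
  | @Algebra.add _ ?b ?c => let env1 := lenv env b in lenv env1 c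
  | @Algebra.opp _ ?b => lenv env b
  | @Algebra.zero _ => env
  | @GRing.scale _ _ _ ?b => lenv env b
  | @Algebra.natmul _ ?b _ => lenv env b
  | _ =>
    match goal with
    | _ => let _ := lindex a env in env
    | _ => constr:(a :: env)
    end
  end.

Ltac lreify K env a :=
  lazymatch a with
  | @Algebra.add _ ?b ?c =>
    let e := lreify K env b in let f := lreify K env c in constr:(@LAdd K e f)
  | @Algebra.opp _ ?b => let e := lreify K env b in constr:(@LOpp K e)
  | @Algebra.zero _ => constr:(@LZero K)
  | @GRing.scale _ _ ?c ?b => let e := lreify K env b in constr:(@LScale K c e)
  | @Algebra.natmul _ ?b ?n => let e := lreify K env b in constr:(@LNat K e n)
  | _ => let i := lindex a env in constr:(@LAtom K i)
  end.

(* Decides identities between linear combinations in the [K]-module [A] by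
   comparing the coefficients of each atom with [ring]. *)
Ltac lmodule K A :=
  lazymatch goal with
  | |- @eq _ ?a ?b =>
    let env0 := lenv (@nil A) a in
    let env := lenv env0 b in
    let e := lreify K env a in
    let f := lreify K env b in
    change (@leval K A env e = @leval K A env f);
    apply: leval_eq; cbn [lall size lcoef eqn]; do ?split; try ring
  end.

(** * Functionals on polynomial algebras *)

Section LinearExtension.
Variables (K : fieldType) (A : lmodType K).

Lemma mpoly_linear_eq n (L L' : {linear {mpoly K[n]} -> A}) :
  (forall m, L 'X_[m] = L' 'X_[m]) -> L =1 L'.
Proof.
move=> LX p; rewrite [p]mpolyE !linear_sum /=.
by apply: eq_bigr => m _; rewrite !linearZ /= LX.
Qed.

Definition mlin n (phi : 'X_{1..n} -> A) (p : {mpoly K[n]}) : A :=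
  \sum_(m <- msupp p) p@_m *: phi m.

(** A common degree bound gives several polynomials the same index set, so that [mlin_linear] can
    add their sums termwise. *)
Lemma mlinwE n (phi : 'X_{1..n} -> A) k (p : {mpoly K[n]}) : (msize p <= k)%N ->
  mlin phi p = \sum_(m : 'X_{1..n < k}) p@_m *: phi m.
Proof.
move=> le_pk; rewrite /mlin (ssrcomplements.big_mksub 'X_{1..n < k}) ?msupp_uniq //=;
  last first.
  by move=> x /msize_mdeg_lt /leq_trans; apply.
rewrite big_rmcond //= => j /memN_msupp_eq0 ->.
by rewrite scale0r.
Qed.

Lemma mlin_linear n (phi : 'X_{1..n} -> A) : linear (mlin phi).
Proof.
move=> c p q; pose k := maxn (msize (c *: p + q)) (maxn (msize p) (msize q)).
rewrite !(@mlinwE _ _ k) ?leq_max ?leqnn ?orbT //.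
rewrite scaler_sumr -big_split /=; apply: eq_bigr => m _.
by rewrite mcoeffD mcoeffZ scalerDl scalerA.
Qed.

HB.instance Definition _ n (phi : 'X_{1..n} -> A) :=
  GRing.isLinear.Build K {mpoly K[n]} A _ (mlin phi) (mlin_linear phi).

Lemma mlinX n (phi : 'X_{1..n} -> A) m : mlin phi 'X_[m] = phi m.
Proof. by rewrite /mlin msuppX big_seq1 mcoeffX eqxx scale1r. Qed.

End LinearExtension.

(** * Substitutions between polynomial algebras *)

Section Substitution.
Variable K : fieldType.

Definition msubst n n' (h : 'I_n -> {mpoly K[n']}) (p : {mpoly K[n]}) :
  {mpoly K[n']} := mmap (@mpolyC n' K) h p.

Lemma msubst_linear n n' (h : 'I_n -> {mpoly K[n']}) : linear (msubst h).
Proof. by move=> c p q; rewrite /msubst mmapD mmapZ mul_mpolyC. Qed.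

Lemma msubst_monoid n n' (h : 'I_n -> {mpoly K[n']}) :
  monoid_morphism (msubst h).
Proof. by split=> [|p q]; rewrite /msubst (rmorph1, rmorphM). Qed.

HB.instance Definition _ n n' (h : 'I_n -> {mpoly K[n']}) :=
  GRing.isLinear.Build K {mpoly K[n]} {mpoly K[n']} _ (msubst h)
    (msubst_linear h).
HB.instance Definition _ n n' (h : 'I_n -> {mpoly K[n']}) :=
  GRing.isMonoidMorphism.Build {mpoly K[n]} {mpoly K[n']} (msubst h)
    (msubst_monoid h).

Lemma msubstD n n' (h : 'I_n -> {mpoly K[n']}) : {morph msubst h : p q / p + q}.
Proof. exact: rmorphD. Qed.
Lemma msubstN n n' (h : 'I_n -> {mpoly K[n']}) : {morph msubst h : p / - p}.
Proof. exact: rmorphN. Qed.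
Lemma msubstM n n' (h : 'I_n -> {mpoly K[n']}) : {morph msubst h : p q / p * q}.
Proof. exact: rmorphM. Qed.

Lemma msubstX n n' (h : 'I_n -> {mpoly K[n']}) i : msubst h 'X_i = h i.
Proof. by rewrite /msubst mmapX mmap1U. Qed.

Lemma eq_msubst n n' (f g : {lrmorphism {mpoly K[n]} -> {mpoly K[n']}}) :
  (forall i, f 'X_i = g 'X_i) -> f =1 g.
Proof.
move=> fg; apply: (@mpoly_linear_eq K {mpoly K[n']} n f g) => m.
rewrite mpolyXE_id !rmorph_prod; apply: eq_bigr => i _.
by rewrite !rmorphXn /= fg.
Qed.

Lemma msubst_id n (p : {mpoly K[n]}) : msubst (fun i => 'X_i) p = p.
Proof.
apply: (@eq_msubst n n (msubst (fun i => 'X_i)) idfun) => i; exact: msubstX.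
Qed.

End Substitution.

(* Sealed, because conversion tests between [inlm] and [inrm] would otherwise
   compute with polynomials. *)
HB.lock Definition inlm (K : fieldType) n n' :
    {mpoly K[n]} -> {mpoly K[n + n']} :=
  msubst (fun i => 'X_(lshift n' i)).
HB.lock Definition inrm (K : fieldType) n n' :
    {mpoly K[n']} -> {mpoly K[n + n']} :=
  msubst (fun i => 'X_(rshift n i)).

(** * Polynomials in two disjoint sets of variables *)

Section Embeddings.
Variable K : fieldType.

Lemma inlm_linear n n' : linear (@inlm K n n').
Proof. rewrite inlm.unlock; exact: linearP. Qed.
Lemma inlm_monoid n n' : monoid_morphism (@inlm K n n').
Proof. by rewrite inlm.unlock; apply: msubst_monoid. Qed.
Lemma inrm_linear n n' : linear (@inrm K n n').
Proof. rewrite inrm.unlock; exact: linearP. Qed.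
Lemma inrm_monoid n n' : monoid_morphism (@inrm K n n').
Proof. by rewrite inrm.unlock; apply: msubst_monoid. Qed.

HB.instance Definition _ n n' :=
  GRing.isLinear.Build K _ _ _ (@inlm K n n') (@inlm_linear n n').
HB.instance Definition _ n n' :=
  GRing.isMonoidMorphism.Build _ _ (@inlm K n n') (@inlm_monoid n n').
HB.instance Definition _ n n' :=
  GRing.isLinear.Build K _ _ _ (@inrm K n n') (@inrm_linear n n').
HB.instance Definition _ n n' :=
  GRing.isMonoidMorphism.Build _ _ (@inrm K n n') (@inrm_monoid n n').

Lemma inlmX n n' i : inlm n' ('X_i : {mpoly K[n]}) = 'X_(lshift n' i).
Proof. by rewrite inlm.unlock msubstX. Qed.
Lemma inrmX n n' i : inrm n ('X_i : {mpoly K[n']}) = 'X_(rshift n i).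
Proof. by rewrite inrm.unlock msubstX. Qed.

Lemma inlmD n n' : {morph @inlm K n n' : p q / p + q}. Proof. exact: rmorphD. Qed.
Lemma inlmN n n' : {morph @inlm K n n' : p / - p}. Proof. exact: rmorphN. Qed.
Lemma inlmM n n' : {morph @inlm K n n' : p q / p * q}. Proof. exact: rmorphM. Qed.
Lemma inlmMn n n' k : {morph @inlm K n n' : p / p *+ k}.
Proof. exact: rmorphMn. Qed.

Lemma inrmD n n' : {morph @inrm K n n' : p q / p + q}. Proof. exact: rmorphD. Qed.
Lemma inrmN n n' : {morph @inrm K n n' : p / - p}. Proof. exact: rmorphN. Qed.
Lemma inrmM n n' : {morph @inrm K n n' : p q / p * q}. Proof. exact: rmorphM. Qed.
Lemma inrmMn n n' k : {morph @inrm K n n' : p / p *+ k}.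
Proof. exact: rmorphMn. Qed.

Definition inmE := (inlmD, inlmN, inlmM, inlmMn, inrmD, inrmN, inrmM, inrmMn).

Definition msplit n n' n'' (h : 'I_n -> {mpoly K[n'']})
    (h' : 'I_n' -> {mpoly K[n'']}) (i : 'I_(n + n')) : {mpoly K[n'']} :=
  match split i with inl j => h j | inr j => h' j end.

Lemma msubst_inl n n' n'' (h : 'I_n -> {mpoly K[n'']})
    (h' : 'I_n' -> {mpoly K[n'']}) p :
  msubst (msplit h h') (inlm n' p) = msubst h p.
Proof.
apply: (@eq_msubst K n n'' (msubst (msplit h h') \o @inlm K n n') (msubst h)) => i.
by rewrite /= inlmX !msubstX /msplit (unsplitK (inl i)).
Qed.

Lemma msubst_inr n n' n'' (h : 'I_n -> {mpoly K[n'']})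
    (h' : 'I_n' -> {mpoly K[n'']}) p :
  msubst (msplit h h') (inrm n p) = msubst h' p.
Proof.
apply: (@eq_msubst K n' n'' (msubst (msplit h h') \o @inrm K n n') (msubst h')) => i.
by rewrite /= inrmX !msubstX /msplit (unsplitK (inr i)).
Qed.

Lemma msubst_inlm_comp n n' n'' (h : 'I_n -> {mpoly K[n']}) p :
  msubst (fun i => inlm n'' (h i)) p = inlm n'' (msubst h p).
Proof.
apply: (@eq_msubst K n _ (msubst (fun i => inlm n'' (h i)))
  (@inlm K n' n'' \o msubst h)) => i.
by rewrite /= !msubstX.
Qed.

Lemma msubst_inrm_comp n n' n'' (h : 'I_n -> {mpoly K[n']}) p :
  msubst (fun i => inrm n'' (h i)) p = inrm n'' (msubst h p).
Proof.
apply: (@eq_msubst K n _ (msubst (fun i => inrm n'' (h i)))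
  (@inrm K n'' n' \o msubst h)) => i.
by rewrite /= !msubstX.
Qed.

Definition msubstE := (msubstD, msubstN, msubstM, msubst_inl, msubst_inr).

Definition mnml n n' (m : 'X_{1..(n + n')}) : 'X_{1..n} :=
  [multinom m (lshift n' i) | i < n].
Definition mnmr n n' (m : 'X_{1..(n + n')}) : 'X_{1..n'} :=
  [multinom m (rshift n i) | i < n'].

Lemma mpolyX_split n n' (m : 'X_{1..(n + n')}) :
  'X_[m] = inlm n' 'X_[mnml m] * inrm n 'X_[mnmr m] :> {mpoly K[n + n']}.
Proof.
rewrite [in LHS]mpolyXE_id big_split_ord ![in RHS]mpolyXE_id !rmorph_prod.
congr (_ * _); apply: eq_bigr => i _.
  by rewrite rmorphXn /= inlmX mnmE.
by rewrite rmorphXn /= inrmX mnmE.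
Qed.

Definition mnm_cat n n' (m : 'X_{1..n}) (m' : 'X_{1..n'}) : 'X_{1..(n + n')} :=
  [multinom match split i with inl j => m j | inr j => m' j end | i < n + n'].

Lemma mnml_cat n n' (m : 'X_{1..n}) (m' : 'X_{1..n'}) : mnml (mnm_cat m m') = m.
Proof. by apply/mnmP => i; rewrite !mnmE (unsplitK (inl i)). Qed.

Lemma mnmr_cat n n' (m : 'X_{1..n}) (m' : 'X_{1..n'}) : mnmr (mnm_cat m m') = m'.
Proof. by apply/mnmP => i; rewrite !mnmE (unsplitK (inr i)). Qed.

Lemma mderivXi n (i j : 'I_n) : ('X_j : {mpoly K[n]})^`M(i) = (i == j)%:R.
Proof.
rewrite mderivX mnm1E eq_sym; case: eqP => [->|_]; last by rewrite scale0r.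
have XX k : (U_(k) - U_(k))%MM = 0%MM :> 'X_{1..n}.
  by apply/mnmP => l; rewrite !mnmE subnn.
by rewrite XX mpolyX0 scale1r.
Qed.

Lemma mderiv_inl n n' i (p : {mpoly K[n]}) :
  (inlm n' p)^`M(lshift n' i) = inlm n' (p^`M(i)).
Proof.
apply: (@mpoly_linear_eq K _ n (mderiv (lshift n' i) \o @inlm K n n')
  (@inlm K n n' \o mderiv i)) => m /=.
have -> : inlm n' 'X_[m] = 'X_[mnm_cat m 0] :> {mpoly K[n + n']}.
  by rewrite mpolyX_split mnml_cat mnmr_cat mpolyX0 rmorph1 mulr1.
rewrite !mderivX linearZ /= mnmE (unsplitK (inl i)); congr (_ *: _).
rewrite mpolyX_split -[RHS]mulr1 -(rmorph1 (@inrm K n n')) -mpolyX0.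
congr (inlm _ 'X_[_] * inrm _ 'X_[_]); apply/mnmP => j.
  by rewrite !mnmE (unsplitK (inl j)) eq_lshift.
by rewrite !mnmE (unsplitK (inr j)) mnm0E sub0n.
Qed.

Lemma mderiv_inr n n' i (p : {mpoly K[n']}) :
  (inrm n p)^`M(rshift n i) = inrm n (p^`M(i)).
Proof.
apply: (@mpoly_linear_eq K _ n' (mderiv (rshift n i) \o @inrm K n n')
  (@inrm K n n' \o mderiv i)) => m /=.
have -> : inrm n 'X_[m] = 'X_[mnm_cat 0 m] :> {mpoly K[n + n']}.
  by rewrite mpolyX_split mnml_cat mnmr_cat mpolyX0 rmorph1 mul1r.
rewrite !mderivX linearZ /= mnmE (unsplitK (inr i)); congr (_ *: _).
rewrite mpolyX_split -[RHS]mul1r -(rmorph1 (@inlm K n n')) -mpolyX0.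
congr (inlm _ 'X_[_] * inrm _ 'X_[_]); apply/mnmP => j.
  by rewrite !mnmE (unsplitK (inl j)) mnm0E sub0n.
by rewrite !mnmE (unsplitK (inr j)) eq_rshift.
Qed.

Lemma mderiv_inl_inr n n' i (p : {mpoly K[n']}) :
  (inrm n p)^`M(lshift n' i) = 0.
Proof.
apply: (@mpoly_linear_eq K _ n' (mderiv (lshift n' i) \o @inrm K n n') \0) => m /=.
have -> : inrm n 'X_[m] = 'X_[mnm_cat 0 m] :> {mpoly K[n + n']}.
  by rewrite mpolyX_split mnml_cat mnmr_cat mpolyX0 rmorph1 mul1r.
by rewrite mderivX mnmE (unsplitK (inl i)) mnmE scale0r.
Qed.

Lemma mderiv_inr_inl n n' i (p : {mpoly K[n]}) :
  (inlm n' p)^`M(rshift n i) = 0.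
Proof.
apply: (@mpoly_linear_eq K _ n (mderiv (rshift n i) \o @inlm K n n') \0) => m /=.
have -> : inlm n' 'X_[m] = 'X_[mnm_cat m 0] :> {mpoly K[n + n']}.
  by rewrite mpolyX_split mnml_cat mnmr_cat mpolyX0 rmorph1 mulr1.
by rewrite mderivX mnmE (unsplitK (inr i)) mnmE scale0r.
Qed.

Lemma mderiv_exp n (i : 'I_n) (p : {mpoly K[n]}) k :
  (p ^+ k)^`M(i) = (p ^+ k.-1 *+ k) * p^`M(i).
Proof.
elim: k => [|k IHk]; first by rewrite expr0 mulr0n mul0r -mpolyC1 mderivC.
rewrite exprS mderivM IHk mulrA mulrnAr mulrSr mulrDl addrC [p^`M(i) * _]mulrC /=.
by case: k {IHk} => [|k]; rewrite ?mulr0n // -exprS.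
Qed.

End Embeddings.

(** * Tensor products of functionals *)

Section TensorFunctional.
Variables (K : fieldType) (A : lmodType K).
Variable mul : {bilinear A -> A -> A}.

(** This is [L] tensored with [L'] and followed by [mul], polynomials in [n + n'] variables being
    read as the tensor product of two polynomial algebras. *)
Definition mtens n n' (L : {mpoly K[n]} -> A) (L' : {mpoly K[n']} -> A) :
    {mpoly K[n + n']} -> A :=
  mlin (fun m => mul (L 'X_[mnml m]) (L' 'X_[mnmr m])).
HB.instance Definition _ n n' L L' := GRing.Linear.on (@mtens n n' L L').

Lemma mtensM n n' (L : {linear {mpoly K[n]} -> A})
    (L' : {linear {mpoly K[n']} -> A}) p q :
  mtens L L' (inlm n' p * inrm n q) = mul (L p) (L' q).
Proof.
have mX m m' : mtens L L' (inlm n' 'X_[m] * inrm n 'X_[m'])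
    = mul (L 'X_[m]) (L' 'X_[m']).
  have := mlinX (fun k => mul (L 'X_[mnml k]) (L' 'X_[mnmr k])) (mnm_cat m m').
  by rewrite mnml_cat mnmr_cat mpolyX_split mnml_cat mnmr_cat.
move: p; apply: (@mpoly_linear_eq K A n
  (mtens L L' \o (inrm n q \o* @inlm K n n')) (applyr mul (L' q) \o L)) => m /=.
move: q; apply: (@mpoly_linear_eq K A n'
  (mtens L L' \o (inlm n' 'X_[m] \*o @inrm K n n')) (mul (L 'X_[m]) \o L')) => m'.
exact: mX.
Qed.

(** Every monomial is a product of one monomial in each set of variables. *)
Lemma eq_mtens n n' (G G' : {linear {mpoly K[n + n']} -> A}) :
  (forall p q, G (inlm n' p * inrm n q) = G' (inlm n' p * inrm n q)) ->
  G =1 G'.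
Proof.
by move=> GG'; apply: mpoly_linear_eq => m; rewrite mpolyX_split GG'.
Qed.

(** Rewrites both factors of a tensor functional at once; it serves for the shear of one factor and
    for the jet of an inner bracket. *)
Lemma mtens_subst n n' r r'
    (L : {linear {mpoly K[n]} -> A}) (M : {linear {mpoly K[n']} -> A})
    (L' : {linear {mpoly K[r]} -> A}) (M' : {linear {mpoly K[r']} -> A})
    (h : 'I_n -> {mpoly K[r]}) (k : 'I_n' -> {mpoly K[r']}) u v :
  (forall p, L p = L' (msubst h p * u)) ->
  (forall p, M p = M' (msubst k p * v)) ->
  forall p, mtens L M p =
    mtens L' M' (msubst (msplit (fun i => inlm r' (h i)) (fun i => inrm r (k i))) p
                 * (inlm r' u * inrm r v)).
Proof.
move=> LL' MM'; set s := msubst _; set w := _ * inrm r v.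
apply: (@eq_mtens _ _ _ (mtens L' M' \o (w \o* idfun) \o s)) => p q /=.
rewrite mtensM LL' MM' -mtensM !rmorphM /= msubst_inl msubst_inr.
by rewrite msubst_inlm_comp msubst_inrm_comp; congr (mtens _ _ _); rewrite mulrACA.
Qed.

Hypothesis mulA : associative mul.

(** Variables are regrouped by a substitution rather than by a cast along associativity of
    addition. *)
Definition massoc n n' r : {mpoly K[n + n' + r]} -> {mpoly K[n + (n' + r)]} :=
  msubst (msplit (msplit (fun i => inlm (n' + r) 'X_i)
                         (fun i => inrm n (inlm r 'X_i)))
                 (fun i => inrm n (inrm n' 'X_i))).

HB.instance Definition _ n n' r := GRing.LRMorphism.on (@massoc n n' r).

Lemma massocD n n' r : {morph @massoc n n' r : p q / p + q}.
Proof. exact: rmorphD. Qed.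
Lemma massocN n n' r : {morph @massoc n n' r : p / - p}.
Proof. exact: rmorphN. Qed.
Lemma massocM n n' r : {morph @massoc n n' r : p q / p * q}.
Proof. exact: rmorphM. Qed.

Lemma massoc_ll n n' r (p : {mpoly K[n]}) :
  @massoc n n' r (inlm r (inlm n' p)) = inlm (n' + r) p.
Proof. by rewrite /massoc !msubst_inl msubst_inlm_comp msubst_id. Qed.

Lemma massoc_lr n n' r (p : {mpoly K[n']}) :
  @massoc n n' r (inlm r (inrm n p)) = inrm n (inlm r p).
Proof.
rewrite /massoc msubst_inl msubst_inr msubst_inrm_comp.
by rewrite msubst_inlm_comp msubst_id.
Qed.

Lemma massoc_r n n' r (p : {mpoly K[r]}) :
  @massoc n n' r (inrm (n + n') p) = inrm n (inrm n' p).
Proof.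
rewrite /massoc msubst_inr msubst_inrm_comp.
by rewrite msubst_inrm_comp msubst_id.
Qed.

Definition massocE := (massocD, massocN, massocM, massoc_ll, massoc_lr, massoc_r).

Lemma mtensA n n' r (L : {linear {mpoly K[n]} -> A})
    (M : {linear {mpoly K[n']} -> A}) (N : {linear {mpoly K[r]} -> A}) p :
  mtens (mtens L M) N p = mtens L (mtens M N) (@massoc n n' r p).
Proof.
move: p; apply: (@eq_mtens _ _ _ (mtens L (mtens M N) \o @massoc n n' r)) => p q /=.
pose F := mtens (mtens L M) N \o ((inrm (n + n') q) \o* idfun) \o @inlm K (n + n') r.
pose G := mtens L (mtens M N) \o @massoc n n' r \o ((inrm (n + n') q) \o* idfun)
   \o @inlm K (n + n') r.
apply: (@eq_mtens _ _ F G) => {}p t.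
rewrite /F /G /= mtensM /= mtensM !rmorphM /=.
rewrite massoc_ll massoc_lr massoc_r.
by rewrite -mulrA -rmorphM /= mtensM /= mtensM mulA.
Qed.

End TensorFunctional.

Ltac ring_in := repeat match goal with
  | |- context [@inlm ?R ?n ?n' ?f] => generalize (@inlm R n n' f); intro
  | |- context [@inrm ?R ?n ?n' ?f] => generalize (@inrm R n n' f); intro
  end; ring.

(** * Functionals on polynomials in three variables *)

Section JetFunctional.
Variables (K : fieldType) (A : lmodType K).

Definition v0 : 'I_3 := @Ordinal 3 0 isT.
Definition v1 : 'I_3 := @Ordinal 3 1 isT.
Definition v2 : 'I_3 := @Ordinal 3 2 isT.

Definition mjet (J : nat -> nat -> nat -> A) : {mpoly K[3]} -> A :=
  mlin (fun m => J (m v0) (m v1) (m v2)).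
HB.instance Definition _ J := GRing.Linear.on (mjet J).

Variable J : nat -> nat -> nat -> A.

Lemma mjetX m : mjet J 'X_[m] = J (m v0) (m v1) (m v2).
Proof. exact: mlinX. Qed.

Lemma mjet_mul i m : mjet J ('X_i * 'X_[m])
  = J ((i == v0) + m v0) ((i == v1) + m v1) ((i == v2) + m v2).
Proof. by rewrite -mpolyXD mjetX !mnmE. Qed.

(** The subtractions are truncated, but when the exponent of the variable [i] is zero the
    multiplicity [m i] removes the term. *)
Lemma mjet_der i m : mjet J ('X_[m]^`M(i))
  = J (m v0 - (i == v0)) (m v1 - (i == v1)) (m v2 - (i == v2)) *+ m i.
Proof. by rewrite mderivX linearZ /= mjetX !mnmE scaler_nat. Qed.

Lemma mjet_mul_der i j m : mjet J ('X_j * 'X_[m]^`M(i))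
  = J ((j == v0) + (m v0 - (i == v0))) ((j == v1) + (m v1 - (i == v1)))
      ((j == v2) + (m v2 - (i == v2))) *+ m i.
Proof.
by rewrite mderivX -scalerAr linearZ /= -mpolyXD mjetX !mnmE scaler_nat.
Qed.

Lemma mjet_mul2 j j' m : mjet J ('X_j * ('X_j' * 'X_[m]))
  = J ((j == v0) + ((j' == v0) + m v0)) ((j == v1) + ((j' == v1) + m v1))
      ((j == v2) + ((j' == v2) + m v2)).
Proof. by rewrite -!mpolyXD mjetX !mnmE. Qed.

Lemma mjet_mul2_der i j j' m : mjet J ('X_j * ('X_j' * 'X_[m]^`M(i)))
  = J ((j == v0) + ((j' == v0) + (m v0 - (i == v0))))
      ((j == v1) + ((j' == v1) + (m v1 - (i == v1))))
      ((j == v2) + ((j' == v2) + (m v2 - (i == v2)))) *+ m i.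
Proof.
by rewrite mderivX -!scalerAr linearZ /= -!mpolyXD mjetX !mnmE scaler_nat.
Qed.

Lemma mjet_mon k l j : mjet J ('X_v0 ^+ k * 'X_v1 ^+ l * 'X_v2 ^+ j) = J k l j.
Proof.
rewrite !mpolyXn -!mpolyXD mjetX !mnmE /= !mulmnE !mnm1E /=.
by rewrite !(muln1, muln0, mul0n, mul1n, addn0, add0n).
Qed.

End JetFunctional.

Definition mjetE :=
  (mjetX, mjet_mul2_der, mjet_mul2, mjet_mul_der, mjet_mul, mjet_der).

(** * Bilinear products of formal series *)

Section GradedProduct.
Variables (A : zmodType) (br : nat -> A -> A -> A).
Hypothesis br_addl : forall n b, {morph br n ^~ b : a a' / a + a'}.
Hypothesis br_addr : forall n a, {morph br n a : b b' / b + b'}.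

Lemma sum_delta (M e : nat) (u : A) : (e < M)%N ->
  \sum_(p < M) u *+ (e == p)%N = u.
Proof.
move=> lt_eM; rewrite (bigD1 (Ordinal lt_eM)) //= eqxx big1 ?addr0 // => p ne_p.
by rewrite eq_sym; move: ne_p; rewrite -val_eqE /= => /negbTE ->.
Qed.

(** Eliminates the degree [p] of an inner product. The cut at [M] loses nothing: [e >= M] would give
    [g e >= M > n]. *)
Lemma sum_delta_trans (M n e : nat) (u : A) (g : nat -> nat) :
  (n < M)%N -> (forall p, (p <= g p)%N) ->
  \sum_(p < M) u *+ (e == p)%N *+ (g p == n)%N = u *+ (g e == n)%N.
Proof.
move=> lt_nM le_pg; have [lt_eM|le_Me] := ltnP e M.
  rewrite -[RHS](sum_delta _ lt_eM); apply: eq_bigr => p _.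
  by case: eqP => [->|_]; rewrite ?mulr1n // !mulr0n mul0rn.
rewrite big1 => [|p _].
  by rewrite gtn_eqF // (leq_trans _ (le_pg e)) // (leq_trans lt_nM).
by rewrite gtn_eqF ?mulr0n ?mul0rn // (leq_trans (ltn_ord p)).
Qed.

(** For given [s] the constraint leaves at most one [r], and none when [c + s] exceeds [n]. *)
Lemma sum_conv (n c M : nat) (u : nat -> nat -> A) : (n < M)%N ->
  \sum_(r < M) \sum_(s < M) u r s *+ (c + s + r == n)%N
  = if (c <= n)%N then \sum_(m < (n - c).+1) u (n - c - m)%N m else 0.
Proof.
move=> lt_nM; rewrite exchange_big /=; case: leqP => [le_cn|lt_nc]; last first.
  rewrite big1 // => s _; rewrite big1 // => r _.
  by rewrite gtn_eqF // (leq_trans lt_nc) // -addnA leq_addr.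
have le_NM : ((n - c).+1 <= M)%N by rewrite (leq_trans _ lt_nM) // ltnS leq_subr.
rewrite (big_ord_widen M (fun m => u (n - c - m)%N m) le_NM) [RHS]big_mkcond /=.
apply: eq_bigr => s _; case: ltnP => [le_s|lt_s]; last first.
  rewrite big1 // => r _; rewrite gtn_eqF ?mulr0n // (leq_trans _ (leq_addr _ _)) //.
  by move: lt_s; rewrite -(ltn_add2l c) subnKC.
have lt_r : (n - c - s < M)%N.
  by rewrite (leq_ltn_trans _ lt_nM) // -subnDA leq_subr.
rewrite (bigD1 (Ordinal lt_r)) //= big1 ?addr0 => [|r ne_r].
  have le_cs : (c + s <= n)%N by rewrite -leq_subRL.
  by rewrite -subnDA subnKC // eqxx.
move: ne_r; rewrite -val_eqE /= => ne_r; case: eqP => // E; case/eqP: ne_r.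
by rewrite -E -subnDA addKn.
Qed.

(** Convertible to [rc_star] when [br] is the Rankin-Cohen bracket. *)
Definition gstar (f g : nat -> A) : nat -> A := fun n =>
  \sum_(i < n.+1) \sum_(j < n.+1 | (i + j <= n)%N)
    br (n - (i + j)) (f i) (g j).

Lemma br0l n b : br n 0 b = 0.
Proof. by apply: (addIr (br n 0 b)); rewrite -br_addl !add0r. Qed.

Lemma br0r n a : br n a 0 = 0.
Proof. by apply: (addIr (br n a 0)); rewrite -br_addr !add0r. Qed.

Lemma br_suml n b I (r : seq I) (F : I -> A) :
  br n (\sum_(i <- r) F i) b = \sum_(i <- r) br n (F i) b.
Proof. exact: (big_morph (br n ^~ b) (br_addl n b) (br0l n b)). Qed.

Lemma br_sumr n a I (r : seq I) (F : I -> A) :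
  br n a (\sum_(i <- r) F i) = \sum_(i <- r) br n a (F i).
Proof. exact: (big_morph (br n a) (br_addr n a) (br0r n a)). Qed.

Lemma br_deltal n a b (e : bool) : br n (a *+ e) b = br n a b *+ e.
Proof. by case: e; rewrite ?mulr1n // !mulr0n br0l. Qed.

Lemma br_deltar n a b (e : bool) : br n a (b *+ e) = br n a b *+ e.
Proof. by case: e; rewrite ?mulr1n // !mulr0n br0r. Qed.

Lemma sum_widen0 n M (F : nat -> A) : (n < M)%N ->
  (forall j, (n < j)%N -> F j = 0) -> \sum_(j < n.+1) F j = \sum_(j < M) F j.
Proof.
move=> lt_nM F0; rewrite (big_ord_widen M F lt_nM) big_mkcond /=.
by apply: eq_bigr => j _; case: ltnP => // /F0 ->.
Qed.

(** Dependent ranges become a common bound and an indicator of the total degree, so that sums can be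
    exchanged freely. *)
Lemma gstarE M f g n : (n < M)%N ->
  gstar f g n
  = \sum_(i < M) \sum_(j < M) \sum_(r < M) br r (f i) (g j) *+ (i + j + r == n)%N.
Proof.
move=> lt_nM; pose G i j : A :=
  if (i + j <= n)%N then br (n - (i + j)) (f i) (g j) else 0.
have G0 i j : (n < i + j)%N -> G i j = 0 by rewrite /G ltnNge => /negbTE ->.
transitivity (\sum_(i < M) \sum_(j < M) G i j).
  rewrite -(@sum_widen0 n M (fun i => \sum_(j < M) G i j)) // => [|i lt_ni].
    apply: eq_bigr => i _; rewrite -(@sum_widen0 n M (G i)) // => [|j lt_nj].
      by rewrite big_mkcond.
    by rewrite G0 // (leq_trans lt_nj) ?leq_addl.
  by rewrite big1 // => j _; rewrite G0 // (leq_trans lt_ni) ?leq_addr.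
apply: eq_bigr => i _; apply: eq_bigr => j _; rewrite /G.
case: leqP => [le_ijn|lt_n].
  have lt_r : (n - (i + j) < M)%N by rewrite (leq_ltn_trans _ lt_nM) // leq_subr.
  rewrite -[LHS](sum_delta _ lt_r); apply: eq_bigr => r _.
  by rewrite -(eqn_add2l (i + j)) subnKC // eq_sym;
    case: eqP => // <-; rewrite addKn.
by rewrite big1 // => r _; rewrite gtn_eqF // (leq_trans lt_n) ?leq_addr.
Qed.

Hypothesis br_assoc : forall N a b c,
  \sum_(m < N.+1) br (N - m) a (br m b c) = \sum_(m < N.+1) br (N - m) (br m a b) c.

(** Both bracketings expand into sums over the degrees of three coefficients and of two brackets,
    with total degree [n]. *)
Lemma gstarA : associative gstar.
Proof.
move=> f g h; apply/funext => n.
pose M := n.+1; have lt_nM : (n < M)%N by [].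
transitivity (\sum_(i < M) \sum_(j < M) \sum_(k < M) \sum_(r < M) \sum_(s < M)
   br r (f i) (br s (g j) (h k)) *+ (i + j + k + s + r == n)%N).
  rewrite (gstarE _ _ lt_nM); apply: eq_bigr => i _.
  transitivity (\sum_(p < M) \sum_(r < M) \sum_(j < M) \sum_(k < M) \sum_(s < M)
     br r (f i) (br s (g j) (h k)) *+ (j + k + s == p)%N *+ (i + p + r == n)%N).
    apply: eq_bigr => p _; apply: eq_bigr => r _; rewrite (gstarE _ _ (ltn_ord p)).
    rewrite br_sumr -sumrMnl; apply: eq_bigr => j _.
    rewrite br_sumr -sumrMnl; apply: eq_bigr => k _.
    rewrite br_sumr -sumrMnl; apply: eq_bigr => s _.
    by rewrite br_deltar.
  rewrite exchange_big /=.
  under eq_bigr do rewrite exchange_big /=.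
  rewrite exchange_big /=; apply: eq_bigr => j _.
  under eq_bigr do rewrite exchange_big /=.
  rewrite exchange_big /=; apply: eq_bigr => k _; apply: eq_bigr => r _.
  rewrite exchange_big /=; apply: eq_bigr => s _.
  rewrite (sum_delta_trans (g := fun p => (i + p + r)%N) _ _ lt_nM) => [|p].
    by rewrite !addnA.
  by rewrite -addnA addnCA leq_addr.
transitivity (\sum_(i < M) \sum_(j < M) \sum_(k < M) \sum_(r < M) \sum_(s < M)
   br r (br s (f i) (g j)) (h k) *+ (i + j + k + s + r == n)%N).
  apply: eq_bigr => i _; apply: eq_bigr => j _; apply: eq_bigr => k _.
  (* For fixed [i], [j], [k] what remains is [br_assoc] at [N = n - (i + j + k)], both sides being
     zero if [i + j + k] exceeds [n]. *)
  rewrite (sum_conv _ (fun r s => br r (f i) (br s (g j) (h k)))) //.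
  rewrite (sum_conv _ (fun r s => br r (br s (f i) (g j)) (h k))) //.
  by rewrite br_assoc.
apply: esym; rewrite (gstarE _ _ lt_nM).
transitivity (\sum_(p < M) \sum_(k < M) \sum_(r < M)
    \sum_(i < M) \sum_(j < M) \sum_(s < M)
   br r (br s (f i) (g j)) (h k) *+ (i + j + s == p)%N *+ (p + k + r == n)%N).
  apply: eq_bigr => p _; apply: eq_bigr => k _; apply: eq_bigr => r _.
  rewrite (gstarE _ _ (ltn_ord p)) br_suml -sumrMnl; apply: eq_bigr => i _.
  rewrite br_suml -sumrMnl; apply: eq_bigr => j _.
  rewrite br_suml -sumrMnl; apply: eq_bigr => s _.
  by rewrite br_deltal.
under eq_bigr do under eq_bigr do rewrite exchange_big /=.
under eq_bigr do rewrite exchange_big /=.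
rewrite exchange_big /=; apply: eq_bigr => i _.
under eq_bigr do under eq_bigr do rewrite exchange_big /=.
under eq_bigr do rewrite exchange_big /=.
rewrite exchange_big /=; apply: eq_bigr => j _.
rewrite exchange_big /=; apply: eq_bigr => k _.
rewrite exchange_big /=; apply: eq_bigr => r _.
rewrite exchange_big /=; apply: eq_bigr => s _.
rewrite (sum_delta_trans (g := fun p => (p + k + r)%N) _ _ lt_nM) => [|p].
  by rewrite -!addnA [(s + (k + _))%N]addnCA.
by rewrite -addnA leq_addr.
Qed.

Lemma gstar_addl f f' g :
  gstar (fun n => f n + f' n) g = (fun n => gstar f g n + gstar f' g n).
Proof.
apply/funext => n; rewrite /gstar -big_split.
apply: eq_bigr => i _; rewrite -big_split; apply: eq_bigr => j _.
exact: br_addl.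
Qed.

Lemma gstar_addr f g g' :
  gstar f (fun n => g n + g' n) = (fun n => gstar f g n + gstar f g' n).
Proof.
apply/funext => n; rewrite /gstar -big_split.
apply: eq_bigr => i _; rewrite -big_split; apply: eq_bigr => j _.
exact: br_addr.
Qed.

End GradedProduct.

(** * Bilinearity over formal power series *)

Section GradedScaling.
Variables (K : fieldType) (A : lmodType K) (br : nat -> A -> A -> A).
Hypothesis br_linl : forall n b, linear (br n ^~ b).
Hypothesis br_linr : forall n a, linear (br n a).

Let br_addl n b : {morph br n ^~ b : a a' / a + a'}.
Proof. by move=> a a'; have := br_linl n b 1 a a'; rewrite !scale1r. Qed.
Let br_addr n a : {morph br n a : b b' / b + b'}.
Proof. by move=> b b'; have := br_linr n a 1 b b'; rewrite !scale1r. Qed.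
Let br_scalel n b c a : br n (c *: a) b = c *: br n a b.
Proof. exact: (scalable_linear (br_linl n b)). Qed.
Let br_scaler n a c b : br n a (c *: b) = c *: br n a b.
Proof. exact: (scalable_linear (br_linr n a)). Qed.

Lemma hscaleE M c (f : nat -> A) n : (n < M)%N ->
  hscale c f n = \sum_(i < M) \sum_(j < M) (c i *: f j) *+ (i + j == n)%N.
Proof.
move=> lt_nM; pose G i : A := if (i <= n)%N then c i *: f (n - i)%N else 0.
transitivity (\sum_(i < M) G i).
  rewrite -(@sum_widen0 A n M G) //; last by move=> i; rewrite /G ltnNge => /negbTE ->.
  by apply: eq_bigr => i _; rewrite /G -ltnS ltn_ord.
apply: eq_bigr => i _; rewrite /G; case: leqP => [le_in|lt_ni].
  have lt_r : (n - i < M)%N by rewrite (leq_ltn_trans _ lt_nM) // leq_subr.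
  rewrite -[LHS](sum_delta _ lt_r); apply: eq_bigr => r _.
  by rewrite -(eqn_add2l i) subnKC // eq_sym; case: eqP => // <-; rewrite addKn.
by rewrite big1 // => r _; rewrite gtn_eqF // (leq_trans lt_ni) ?leq_addr.
Qed.

(** The normal form to which scaling in either argument is reduced. *)
Let hscale_gstarE c f g n :
  hscale c (gstar br f g) n
  = \sum_(i < n.+1) \sum_(i' < n.+1) \sum_(j < n.+1) \sum_(r < n.+1)
      (c i *: br r (f i') (g j)) *+ (i + i' + j + r == n)%N.
Proof.
rewrite (@hscaleE n.+1) //; apply: eq_bigr => i _.
transitivity (\sum_(p < n.+1) \sum_(i' < n.+1) \sum_(j < n.+1) \sum_(r < n.+1)
   (c i *: br r (f i') (g j)) *+ (i' + j + r == p)%N *+ (i + p == n)%N).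
  apply: eq_bigr => p _; rewrite (gstarE br _ _ (ltn_ord p)).
  rewrite scaler_sumr -sumrMnl; apply: eq_bigr => i' _.
  rewrite scaler_sumr -sumrMnl; apply: eq_bigr => j _.
  rewrite scaler_sumr -sumrMnl; apply: eq_bigr => r _.
  by rewrite scalerMnr.
rewrite exchange_big /=; apply: eq_bigr => i' _.
rewrite exchange_big /=; apply: eq_bigr => j _.
rewrite exchange_big /=; apply: eq_bigr => r _.
rewrite (sum_delta_trans (g := fun p => (i + p)%N) _ _ (ltnSn n)) => [|p].
  by rewrite !addnA.
exact: leq_addl.
Qed.

Lemma gstar_scalel c f g : gstar br (hscale c f) g = hscale c (gstar br f g).
Proof.
apply/funext => n; rewrite hscale_gstarE.
rewrite (gstarE br _ _ (ltnSn n)).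
transitivity (\sum_(p < n.+1) \sum_(j < n.+1) \sum_(r < n.+1)
    \sum_(i < n.+1) \sum_(i' < n.+1)
   (c i *: br r (f i') (g j)) *+ (i + i' == p)%N *+ (p + j + r == n)%N).
  apply: eq_bigr => p _; apply: eq_bigr => j _; apply: eq_bigr => r _.
  rewrite (hscaleE _ _ (ltn_ord p)) (br_suml br_addl) -sumrMnl; apply: eq_bigr => i _.
  rewrite (br_suml br_addl) -sumrMnl; apply: eq_bigr => i' _.
  by rewrite (br_deltal br_addl) br_scalel.
under eq_bigr do under eq_bigr do rewrite exchange_big /=.
under eq_bigr do rewrite exchange_big /=.
rewrite exchange_big /=; apply: eq_bigr => i _.
under eq_bigr do under eq_bigr do rewrite exchange_big /=.
under eq_bigr do rewrite exchange_big /=.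
rewrite exchange_big /=; apply: eq_bigr => i' _.
rewrite exchange_big /=; apply: eq_bigr => j _.
rewrite exchange_big /=; apply: eq_bigr => r _.
rewrite (sum_delta_trans (g := fun p => (p + j + r)%N) _ _ (ltnSn n)) => [//|p].
by rewrite -addnA leq_addr.
Qed.

Lemma gstar_scaler c f g : gstar br f (hscale c g) = hscale c (gstar br f g).
Proof.
apply/funext => n; rewrite hscale_gstarE.
rewrite (gstarE br _ _ (ltnSn n)).
transitivity (\sum_(i' < n.+1) \sum_(p < n.+1) \sum_(r < n.+1)
    \sum_(i < n.+1) \sum_(j < n.+1)
   (c i *: br r (f i') (g j)) *+ (i + j == p)%N *+ (i' + p + r == n)%N).
  apply: eq_bigr => i' _; apply: eq_bigr => p _; apply: eq_bigr => r _.
  rewrite (hscaleE _ _ (ltn_ord p)) (br_sumr br_addr) -sumrMnl; apply: eq_bigr => i _.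
  rewrite (br_sumr br_addr) -sumrMnl; apply: eq_bigr => j _.
  by rewrite (br_deltar br_addr) br_scaler.
under eq_bigr do under eq_bigr do rewrite exchange_big /=.
under eq_bigr do rewrite exchange_big /=.
rewrite exchange_big /=; apply: eq_bigr => i _; apply: eq_bigr => i' _.
under eq_bigr do rewrite exchange_big /=.
rewrite exchange_big /=; apply: eq_bigr => j _.
rewrite exchange_big /=; apply: eq_bigr => r _.
rewrite (sum_delta_trans (g := fun p => (i' + p + r)%N) _ _ (ltnSn n)) => [|p].
  by rewrite !addnA [(i' + i)%N]addnC.
by rewrite -addnA addnCA leq_addr.
Qed.

End GradedScaling.

(** * Projective actions *)

Local Arguments hdelta : simpl never.

Section ProjectiveAction.
Variables (K : fieldType) (A : lmodType K).
Variables (mul : {bilinear A -> A -> A}) (act : {bilinear H1 K -> A -> A}).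
Variable Omega : A.
Hypothesis K0 : [pchar K] =i pred0.
Hypothesis mulA : associative mul.
Hypothesis proj : H1_projective mul act Omega.
Hypothesis YOmega : act (hY K) Omega = 2%:R *: Omega.

Local Notation X := (act (hX K)).
Local Notation Y := (act (hY K)).
Local Notation D := (act (2%:R^-1 *: hdelta K 1)).
Local Notation W := (2%:R^-1 *: Omega).

Let actP := proj_action proj.
Let act1 := action1 actP.
Let actM := actionM actP.

Let actD (h k : H1 K) a : act (h + k) a = act h a + act k a.
Proof. exact: linearDl. Qed.
Let actN (h : H1 K) a : act (- h) a = - act h a.
Proof. exact: linearNl. Qed.
Let actZ c (h : H1 K) a : act (c *: h) a = c *: act h a.
Proof. exact: linearZl_LR. Qed.

Lemma act_hdelta1 a : act (hdelta K 1) a = D a *+ 2.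
Proof.
by rewrite actZ -scaler_nat scalerA divff ?scale1r // (iffLR (pcharf0P K) K0).
Qed.

Lemma act_lie h k a : act h (act k a) = act k (act h a) + act (lie h k) a.
Proof. by rewrite /lie actD actN !actM addrC subrK. Qed.

Lemma act_YX a : Y (X a) = X (Y a) + X a.
Proof. by rewrite act_lie hYX. Qed.

Lemma lieZr h k (c : K) : lie h (c *: k) = c *: lie h k :> H1 K.
Proof. by rewrite /lie -scalerAl -scalerAr scalerBr. Qed.

Lemma act_YD a : Y (D a) = D (Y a) + D a.
Proof. by rewrite act_lie lieZr hYdelta scale1r. Qed.

(** The bracket of [X] and [delta_1] is [delta_2], the inner derivation of [Omega] plus half the
    square of [delta_1]. With the halves in [D] and [W] the coefficients become 1. *)
Lemma act_XD a : X (D a) = D (X a) + D (D a) + (mul W a - mul a W).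
Proof.
rewrite act_lie lieZr hXdelta [X in _ + X = _]actZ.
have -> : hdelta K 2 = hdelta2' K + 2%:R^-1 *: hdelta K 1 ^+ 2 by rewrite subrK.
rewrite actD (proj_delta2' proj) scalerDr [X in _ + X = _]addrC addrA.
congr (_ + _ + _); last by rewrite linearZl_LR linearZr_LR scalerBr.
by rewrite -actM -scalerAl -scalerAr -expr2 !actZ.
Qed.

Lemma act_antipodeX a : act (antipode K (hX K)) a = D (Y a) *+ 2 - X a.
Proof.
rewrite antipodeX actD actN addrC -act_hdelta1.
by rewrite -actM.
Qed.

Lemma act_mulX a b : X (mul a b) = mul (X a) b + mul a (X b) + mul (D a *+ 2) (Y b).
Proof.
have := action_mul actP (h := hX K)
  (s := [:: (hX K, 1); (1, hX K); (hdelta K 1, hY K)]).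
rewrite !big_cons big_nil addr0 /= addrA => /(_ (coproductX K)) ->.
by rewrite !big_cons big_nil addr0 /= !act1 addrA act_hdelta1.
Qed.

Lemma act_mulY a b : Y (mul a b) = mul (Y a) b + mul a (Y b).
Proof.
have := action_mul actP (h := hY K) (s := [:: (hY K, 1); (1, hY K)]).
rewrite !big_cons big_nil addr0 /= => /(_ (coproductY K)) ->.
by rewrite !big_cons big_nil addr0 /= !act1.
Qed.

Lemma act_mulD a b : D (mul a b) = mul (D a) b + mul a (D b).
Proof.
have := action_mul actP (h := hdelta K 1) (s := [:: (hdelta K 1, 1); (1, hdelta K 1)]).
rewrite !big_cons big_nil addr0 /= => /(_ (coproductd K)) E.
rewrite actZ E !big_cons big_nil addr0 /= !act1 scalerDr.
by rewrite !actZ linearZl_LR linearZr_LR.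
Qed.

Lemma act_DW : D W = 0.
Proof. by rewrite linearZr_LR actZ (proj_deltaO proj) // !scaler0. Qed.

Lemma act_DWl a : D (mul W a) = mul W (D a).
Proof. by rewrite act_mulD act_DW linear0l add0r. Qed.

Lemma act_DWr a : D (mul a W) = mul (D a) W.
Proof. by rewrite act_mulD act_DW linear0r addr0. Qed.

Lemma iterD_linear j : linear (iter j D).
Proof. by elim: j => [|j IHj] c a b //=; rewrite IHj linearPr. Qed.
HB.instance Definition _ j := GRing.isLinear.Build K A A _ (iter j D) (iterD_linear j).

Lemma act_Y_iterD j a : Y (iter j D a) = iter j D (Y a) + iter j D a *+ j.
Proof.
elim: j => [|j IHj] /=; first by rewrite mulr0n addr0.
by rewrite act_YD IHj linearDr linearMnr -addrA -mulrSr.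
Qed.

Lemma iterD_Wl j a : iter j D (mul W a) = mul W (iter j D a).
Proof. by elim: j => //= j ->; rewrite act_DWl. Qed.

Lemma iterD_Wr j a : iter j D (mul a W) = mul (iter j D a) W.
Proof. by elim: j => //= j ->; rewrite act_DWr. Qed.

(** Each passage of [X] through a [D] costs [act_XD]; the costs add up because [D] commutes with
    both multiplications by [W]. *)
Lemma act_X_iterD j a :
  X (iter j D a) = iter j D (X a) + iter j.+1 D a *+ j
    + (mul W (iter j.-1 D a) - mul (iter j.-1 D a) W) *+ j.
Proof.
elim: j => [|j IHj]; first by rewrite !mulr0n !addr0.
rewrite iterS act_XD IHj !linearDr !linearMnr linearBr act_DWl act_DWr /=.
case: j {IHj} => [|j] /=; first by rewrite !mulr0n !mulr1n !addr0.
by lmodule K A.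
Qed.

Local Notation P l k a := (act (poch (2%:R * hY K + k%:R) l) a).

Let act_nat n a : act n%:R a = a *+ n.
Proof. by rewrite -scaler_nat actZ act1 scaler_nat. Qed.

Let act_2Yn n a : act (2%:R * hY K + n%:R) a = Y a *+ 2 + a *+ n.
Proof. by rewrite actD actM !act_nat. Qed.

Lemma act_pochSr l k a : P l.+1 k a = P l k (Y a *+ 2 + a *+ (k + l)).
Proof. by rewrite /poch big_ord_recr /= actM -addrA -natrD act_2Yn. Qed.

Lemma act_pochSl l k a : P l.+1 k a = Y (P l k.+1 a) *+ 2 + P l k.+1 a *+ k.
Proof.
rewrite {1}/poch big_ord_recl actM addr0 act_2Yn.
suff -> : \prod_(i < l) (2%:R * hY K + k%:R + (bump 0 i)%:R)
  = poch (2%:R * hY K + k.+1%:R) l by [].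
apply: eq_bigr => i _; rewrite -!addrA -!natrD /bump.
by rewrite leq0n add1n addSnnS.
Qed.

Lemma act_Y_poch l k a : Y (P l k a) = P l k (Y a).
Proof.
rewrite -!actM; congr (act _ a); apply: commr_prod => i _.
apply: commrD; last exact: commr_nat.
by apply: commrD; [apply: commrM => //; apply: commr_nat|exact: commr_nat].
Qed.

Lemma poch_linear l k : linear (fun a => P l k a).
Proof. exact: linearPr. Qed.

(** This is $(x)_l=(x+1)_l-l\,(x+1)_{l-1}$ at $x=2Y+k$. *)
Lemma act_poch_shift l k a : P l k a = P l k.+1 a - P l.-1 k.+1 a *+ l.
Proof.
case: l => [|l] /=; first by rewrite mulr0n subr0 /poch !big_ord0.
by rewrite act_pochSl act_pochSr act_Y_poch linearDr !linearMnr; lmodule K A.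
Qed.

(** * Operators given by the two-step recursion, for [Z] of weight 1 and [V] of weight 2 *)

Section Recursion.
Variables Z V : {linear A -> A}.
Hypothesis YZ : forall a, Y (Z a) = Z (Y a) + Z a.
Hypothesis YV : forall a, Y (V a) = V (Y a) + V a *+ 2.

Definition rc_op m := (rc_rec act Z V m).1.

Arguments rc_op : simpl never.

(** At [m = 0] the default [0.-1 = 0] puts $T_0$ in place of $T_{-1}$, harmlessly since the
    multiplicity is zero. *)
Lemma rc_opS m a :
  rc_op m.+1 a = Z (rc_op m a)
    - V (act (hY K - ((m%:R - 1) / 2%:R) *: 1) (rc_op m.-1 a)) *+ m.
Proof. by case: m => [|m]; rewrite -scaler_nat // /rc_op /= !scale0r. Qed.

Lemma rc_op_ind (Q : nat -> (A -> A) -> Prop) :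
  Q 0%N id ->
  (forall m, Q m (rc_op m) -> Q m.-1 (rc_op m.-1) -> Q m.+1 (rc_op m.+1)) ->
  forall m, Q m (rc_op m).
Proof.
move=> Q0 QS m; suff: Q m (rc_op m) /\ Q m.-1 (rc_op m.-1) by case.
by elim: m => [|m [Qm Qm']]; split=> //; apply: QS.
Qed.

Lemma rc_op_linear m : linear (rc_op m).
Proof.
move: m; apply: (rc_op_ind (Q := fun m T => linear T)) => [//|m Tm Tm'] c a b.
rewrite !rc_opS Tm Tm' linearPr !linearP /=; lmodule K A.
Qed.

HB.instance Definition _ m :=
  GRing.isLinear.Build K A A _ (rc_op m) (rc_op_linear m).

Lemma act_Y_op m a : Y (rc_op m a) = rc_op m (Y a) + rc_op m a *+ m.
Proof.
move: a; apply: (rc_op_ind (Q := fun m T => forall a, Y (T a) = T (Y a) + T a *+ m)).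
  by move=> a; rewrite mulr0n addr0.
move=> {}m Tm Tm' a.
rewrite !rc_opS; set h := hY K - _.
have Yh b : Y (act h b) = act h (Y b).
  rewrite -!actM; congr (act _ b); apply: commrB => //.
  by rewrite /GRing.comm -scalerAl -scalerAr mulr1 mul1r.
rewrite linearBr linearMnr YZ Tm YV Yh Tm' !linearD !linearMn /=.
case: m h Yh {Tm Tm'} => [|m] h Yh /=; first by lmodule K A.
by lmodule K A.
Qed.

(** The recursion solved for $ZT_m$. As $T_{m-1}$ has weight $m-1$, moving $Y-(m-1)/2$ to its right
    gives $\frac12T_{m-1}(2Y+m-1)$, which has the form of a Pochhammer factor. *)
Lemma act_op_raise m b :
  Z (rc_op m b) = rc_op m.+1 b
    + (2%:R^-1 *: V (rc_op m.-1 (Y b *+ 2 + b *+ m.-1))) *+ m.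
Proof.
case: m => [|m]; rewrite [in RHS]rc_opS ?mulr0n ?addr0 ?subr0 //=.
have -> : m.+1%:R - 1 = m%:R :> K by rewrite -natr1 addrK.
rewrite actD actN actZ act1 act_Y_op.
rewrite !linearD !linearN !linearZ !linearMn /=.
by lmodule K A; field; rewrite (iffLR (pcharf0P K) K0).
Qed.

(* The Taylor coefficients at the base point (0, 1) of the homogeneous function
   on the plane attached to [a]: [k] derivatives along the first coordinate and
   [l] along minus the second one; [D] is half of delta_1. *)
Definition jet k l j a : A := iter j D (rc_op k (P l k a)).

Arguments jet : simpl never.

Lemma jet_linear k l j : linear (jet k l j).
Proof. by move=> c a b; rewrite /jet poch_linear !linearP. Qed.

HB.instance Definition _ k l j :=
  GRing.isLinear.Build K A A _ (jet k l j) (jet_linear k l j).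

Lemma jet0 a : jet 0 0 0 a = a.
Proof. by rewrite /jet /= /poch big_ord0 act1. Qed.

Lemma act_Y_jet k l j a :
  Y (jet k l j a) *+ 2
  = jet k l.+1 j a + jet k l j a *+ (k + 2 * j) - jet k l j a *+ l.
Proof.
rewrite /jet act_pochSr act_Y_iterD act_Y_op act_Y_poch.
rewrite linearDr !linearMnr !linearD !linearMn /=; lmodule K A.
Qed.

(** [act_poch_shift] adapts the Pochhammer factor to the raised index [k.+1]; in the last term the
    factor $2Y+k-1$ lengthens it from [l] to [l.+1]. *)
Lemma act_Z_jet k l a :
  Z (jet k l 0 a) = jet k.+1 l 0 a - jet k.+1 l.-1 0 a *+ l
    + (2%:R^-1 *: V (jet k.-1 l.+1 0 a)) *+ k.
Proof.
rewrite /jet /= act_op_raise {1}(act_poch_shift l k) linearB linearMn.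
congr (_ + _); case: k => [|k]; first by rewrite !mulr0n.
by rewrite /= -act_pochSl.
Qed.

End Recursion.
Arguments rc_op : simpl never.
Arguments jet : simpl never.

(** * Left and right jets *)

Local Notation phi := (jet (act (hX K)) (mul Omega)).

Lemma phi_Wl u : 2%:R^-1 *: mul Omega u = mul W u.
Proof. by rewrite linearZl_LR. Qed.

Lemma phi_Wr u : 2%:R^-1 *: mul u Omega = mul u W.
Proof. by rewrite linearZr_LR. Qed.

(** The weight of [Omega] enters here and in [act_Y_Omegar]: multiplication by [Omega] is an
    admissible [V] in the recursion. *)
Lemma act_Y_Omegal u : Y (mul Omega u) = mul Omega (Y u) + mul Omega u *+ 2.
Proof. by rewrite act_mulY YOmega linearZl_LR addrC scaler_nat. Qed.

Lemma act_Y_Omegar u : Y (mul u Omega) = mul (Y u) Omega + mul u Omega *+ 2.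
Proof. by rewrite act_mulY YOmega linearZr_LR scaler_nat. Qed.

Lemma phi_Y k l j a :
  Y (phi k l j a) *+ 2
  = phi k l.+1 j a + phi k l j a *+ (k + 2 * j) - phi k l j a *+ l.
Proof. exact: act_Y_jet act_YX act_Y_Omegal _ _ _ _. Qed.

(** [act_Z_jet] is the case [j = 0]; the terms with multiplicity [j] come from moving [X] through
    the powers of [D]. *)
Lemma phi_X k l j a :
  X (phi k l j a) = phi k.+1 l j a - phi k.+1 l.-1 j a *+ l
    + mul W (phi k.-1 l.+1 j a) *+ k + phi k l j.+1 a *+ j
    + (mul W (phi k l j.-1 a) - mul (phi k l j.-1 a) W) *+ j.
Proof.
have expand u p q r : X u = p - q *+ l + mul W r *+ k ->
    X (iter j D u) = iter j D p - iter j D q *+ l + mul W (iter j D r) *+ k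
      + iter j.+1 D u *+ j
      + (mul W (iter j.-1 D u) - mul (iter j.-1 D u) W) *+ j.
  by rewrite act_X_iterD => ->; rewrite !linearD !linearN !linearMn /= iterD_Wl.
by apply: expand; rewrite (act_Z_jet act_YX act_Y_Omegal) phi_Wl.
Qed.

(** The relation for [Y] yields the row [k = 0] from its first entry, and the relation for [X]
    yields each next row from the two before it. This is how a family is recognised as a jet. *)
Lemma phi_unique (Psi : nat -> nat -> A) :
  (forall k l, Y (Psi k l) *+ 2 = Psi k l.+1 + Psi k l *+ k - Psi k l *+ l) ->
  (forall k l, X (Psi k l) = Psi k.+1 l - Psi k.+1 l.-1 *+ l
     + mul W (Psi k.-1 l.+1) *+ k) ->
  forall k l, Psi k l = phi k l 0 (Psi 0%N 0%N).
Proof.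
move=> PY PX; elim/ltn_ind => -[|k] IHk.
  elim=> [|l IHl]; first by rewrite jet0.
  have -> : Psi 0%N l.+1 = Y (Psi 0%N l) *+ 2 + Psi 0%N l *+ l.
    by rewrite PY; lmodule K A.
  by rewrite IHl phi_Y; lmodule K A.
have Ek l : Psi k l = phi k l 0 (Psi 0%N 0%N) by apply: IHk.
(* The row [k.-1] also occurs, hence the strong induction; for [k = 0] its coefficient is zero. *)
have Ek' l : mul W (Psi k.-1 l) *+ k = mul W (phi k.-1 l 0 (Psi 0%N 0%N)) *+ k.
  by case: k IHk {Ek} => [|k] IHk; rewrite ?mulr0n //= IHk.
elim=> [|l IHl].
  have -> : Psi k.+1 0%N = X (Psi k 0%N) - mul W (Psi k.-1 1%N) *+ k.
    by rewrite PX; lmodule K A.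
  by rewrite Ek Ek' phi_X; lmodule K A.
have -> : Psi k.+1 l.+1 = X (Psi k l.+1) + Psi k.+1 l *+ l.+1
  - mul W (Psi k.-1 l.+2) *+ k by rewrite PX /=; lmodule K A.
by rewrite Ek Ek' IHl phi_X /=; lmodule K A.
Qed.

(** Minus the action of the antipode of [X]. With this sign the right jets fit the same recursion as
    the left ones. *)
Definition opZ a : A := X a - D (Y a) *+ 2.

Lemma opZ_linear : linear opZ.
Proof. by move=> c a b; rewrite /opZ !linearPr; lmodule K A. Qed.
HB.instance Definition _ := GRing.isLinear.Build K A A _ opZ opZ_linear.

Lemma act_Y_opZ a : Y (opZ a) = opZ (Y a) + opZ a.
Proof.
rewrite /opZ linearBr linearMnr act_YX act_YD; lmodule K A.
Qed.

Local Notation psi := (jet opZ (applyr mul Omega)).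

Lemma psi_Y k l j a :
  Y (psi k l j a) *+ 2
  = psi k l.+1 j a + psi k l j a *+ (k + 2 * j) - psi k l j a *+ l.
Proof. by apply: act_Y_jet; [exact: act_Y_opZ|exact: act_Y_Omegar]. Qed.

(** Here $X=Z+2DY$ with [Z] the operator [opZ]; the summand $2DY$, evaluated by [psi_Y], gives the
    bracketed terms with [j.+1]. *)
Lemma psi_X k l j a :
  X (psi k l j a) = psi k.+1 l j a - psi k.+1 l.-1 j a *+ l
    + mul (psi k.-1 l.+1 j a) W *+ k
    + (psi k l.+1 j.+1 a + psi k l j.+1 a *+ k - psi k l j.+1 a *+ l)
    + psi k l j.+1 a *+ j
    + (mul W (psi k l j.-1 a) - mul (psi k l j.-1 a) W) *+ j.
Proof.
have expand u p q r v : opZ u = p - q *+ l + mul r W *+ k ->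
    Y u *+ 2 = v + u *+ k - u *+ l ->
    X (iter j D u) = iter j D p - iter j D q *+ l + mul (iter j D r) W *+ k
      + (iter j.+1 D v + iter j.+1 D u *+ k - iter j.+1 D u *+ l)
      + iter j.+1 D u *+ j
      + (mul W (iter j.-1 D u) - mul (iter j.-1 D u) W) *+ j.
  rewrite act_X_iterD => Zu Yu.
  have -> : X u = opZ u + D (Y u *+ 2) by rewrite /opZ linearMnr subrK.
  have iterC w : iter j.+1 D w = iter j D (D w) by rewrite iterSr.
  rewrite Zu Yu !linearDr linearNr !linearMnr !linearD !linearN !linearMn /=.
  by rewrite iterD_Wr -!iterC.
apply: (expand (psi k l 0 a)); last first.
  by have := psi_Y k l 0 a; rewrite muln0 addn0.
by rewrite -phi_Wr; apply: act_Z_jet; [exact: act_Y_opZ|exact: act_Y_Omegar].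
Qed.

(** The second term of the recursion lowers the index by two, so changing the sign of [Z] multiplies
    $T_m$ by $(-1)^m$. *)
Lemma opAE m a :
  opA mul act Omega m a = (-1) ^+ m *: rc_op opZ (applyr mul Omega) m a.
Proof.
rewrite /opA /rc_op; set Z := act (antipode K _).
(* The second component, $T_{m-1}$, carries the opposite sign. *)
suff: (rc_rec act Z (mul^~ Omega) m).1 a
   = (-1) ^+ m *: (rc_rec act opZ (applyr mul Omega) m).1 a /\
  (rc_rec act Z (mul^~ Omega) m).2 a
   = - ((-1) ^+ m *: (rc_rec act opZ (applyr mul Omega) m).2 a) by case.
elim: m => [|m [IH1 IH2]] /=; first by rewrite scale1r scaler0 oppr0.
rewrite IH1 IH2 [Z _]act_antipodeX /opZ; move: (rc_rec act opZ _ m) => [T T'] /=.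
split; last by rewrite exprS mulN1r scaleNr opprK.
rewrite !linearZr_LR linearNr linearNl linearZr_LR linearZl_LR exprS.
by lmodule K A.
Qed.

End ProjectiveAction.

(** * Jets as functionals *)

Section Functionals.
Variables (K : fieldType) (A : lmodType K).
Variables (mul : {bilinear A -> A -> A}) (act : {bilinear H1 K -> A -> A}).
Variable Omega : A.
Hypothesis K0 : [pchar K] =i pred0.
Hypothesis mulA : associative mul.
Hypothesis proj : H1_projective mul act Omega.
Hypothesis YOmega : act (hY K) Omega = 2%:R *: Omega.

Local Notation X := (act (hX K)).
Local Notation Y := (act (hY K)).
Local Notation D := (act (2%:R^-1 *: hdelta K 1)).
Local Notation W := (2%:R^-1 *: Omega).
Local Notation phi := (jet act (act (hX K)) (mul Omega)).
Local Notation psi := (jet act (opZ act) (applyr mul Omega)).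
Local Notation Phi a := (mjet (fun k l j => phi k l j a)).
Local Notation Psi a := (mjet (fun k l j => psi k l j a)).
Local Notation xi := ('X_v0 : {mpoly K[3]}).
Local Notation eta := ('X_v1 : {mpoly K[3]}).
Local Notation dd := ('X_v2 : {mpoly K[3]}).

(** * The generators as differential operators on functionals *)

Lemma D_Phi a f : D (Phi a f) = Phi a (dd * f).
Proof.
move: f; apply: (@mpoly_linear_eq K A 3 (D \o Phi a) (Phi a \o (dd \*o idfun))) => m.
by rewrite /= !mjetE /=.
Qed.

Lemma Y_Phi a f :
  Y (Phi a f) *+ 2
  = Phi a (eta * f - eta * f^`M(v1) + xi * f^`M(v0) + (dd * f^`M(v2)) *+ 2).
Proof.
move: f; apply: (@mpoly_linear_eq K A 3 ((Y \o Phi a) \+ (Y \o Phi a)) (Phi a \o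
  ((eta \*o idfun) \- (eta \*o mderiv v1) \+ (xi \*o mderiv v0)
   \+ ((dd \*o mderiv v2) \+ (dd \*o mderiv v2))))) => m.
rewrite /= !linearD linearN /= !mjetE /=.
move: (m v0) (m v1) (m v2) => k l j; rewrite -[LHS]mulr2n phi_Y //.
(* Splitting each exponent resolves the truncated subtractions left by the derivatives. *)
by case: k l j => [|k] [|l] [|j]; rewrite ?subn0 ?subn1 ?add0n ?add1n /=;
  lmodule K A.
Qed.

Lemma X_Phi a f :
  X (Phi a f)
  = Phi a (xi * f - xi * f^`M(v1) + dd * (dd * f^`M(v2)))
    + mul W (Phi a (eta * f^`M(v0) + f^`M(v2))) - mul (Phi a (f^`M(v2))) W.
Proof.
move: f; apply: (@mpoly_linear_eq K A 3 (X \o Phi a)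
  ((Phi a \o ((xi \*o idfun) \- (xi \*o mderiv v1)
               \+ (dd \*o (dd \*o mderiv v2))))
   \+ (mul W \o Phi a \o ((eta \*o mderiv v0) \+ mderiv v2))
   \- (applyr mul W \o Phi a \o mderiv v2))) => m.
rewrite /= !linearD linearN /= !mjetE /= !linearMnr linearMnl.
move: (m v0) (m v1) (m v2) => k l j; rewrite (phi_X K0 proj) //.
by case: k l j => [|k] [|l] [|j]; rewrite ?subn0 ?subn1 ?add0n ?add1n /=;
  lmodule K A.
Qed.

Lemma D_Psi a f : D (Psi a f) = Psi a (dd * f).
Proof.
move: f; apply: (@mpoly_linear_eq K A 3 (D \o Psi a) (Psi a \o (dd \*o idfun))) => m.
by rewrite /= !mjetE /=.
Qed.

Lemma Y_Psi a f :
  Y (Psi a f) *+ 2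
  = Psi a (eta * f - eta * f^`M(v1) + xi * f^`M(v0) + (dd * f^`M(v2)) *+ 2).
Proof.
move: f; apply: (@mpoly_linear_eq K A 3 ((Y \o Psi a) \+ (Y \o Psi a)) (Psi a \o
  ((eta \*o idfun) \- (eta \*o mderiv v1) \+ (xi \*o mderiv v0)
   \+ ((dd \*o mderiv v2) \+ (dd \*o mderiv v2))))) => m.
rewrite /= !linearD linearN /= !mjetE /=.
move: (m v0) (m v1) (m v2) => k l j; rewrite -[LHS]mulr2n psi_Y //.
by case: k l j => [|k] [|l] [|j]; rewrite ?subn0 ?subn1 ?add0n ?add1n /=;
  lmodule K A.
Qed.

Lemma X_Psi a f :
  X (Psi a f)
  = Psi a (xi * f - xi * f^`M(v1) + dd * (dd * f^`M(v2))
           + (dd * (eta * f) - dd * (eta * f^`M(v1)) + dd * (xi * f^`M(v0))))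
    + mul (Psi a (eta * f^`M(v0) - f^`M(v2))) W + mul W (Psi a (f^`M(v2))).
Proof.
move: f; apply: (@mpoly_linear_eq K A 3 (X \o Psi a)
  ((Psi a \o ((xi \*o idfun) \- (xi \*o mderiv v1)
               \+ (dd \*o (dd \*o mderiv v2))
     \+ ((dd \*o (eta \*o idfun)) \- (dd \*o (eta \*o mderiv v1))
         \+ (dd \*o (xi \*o mderiv v0)))))
   \+ (applyr mul W \o Psi a \o ((eta \*o mderiv v0) \- mderiv v2))
   \+ (mul W \o Psi a \o mderiv v2))) => m.
rewrite /= !linearD !linearN /= !mjetE /= ?linearDl ?linearNl !linearMnr !linearMnl.
move: (m v0) (m v1) (m v2) => k l j; rewrite (psi_X K0 proj) //.
by case: k l j => [|k] [|l] [|j]; rewrite ?subn0 ?subn1 ?add0n ?add1n /=;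
  lmodule K A.
Qed.

(** * The shear between right and left jets *)

Lemma mderiv_exp3 n (i : 'I_n) (s t q : {mpoly K[n]}) k l m :
  (s ^+ k * t ^+ l * q ^+ m)^`M(i)
  = (s ^+ k.-1 * t ^+ l * q ^+ m *+ k) * s^`M(i)
    + (s ^+ k * t ^+ l.-1 * q ^+ m *+ l) * t^`M(i)
    + (s ^+ k * t ^+ l * q ^+ m.-1 *+ m) * q^`M(i).
Proof.
by rewrite !mderivM !mderiv_exp; ring.
Qed.

Lemma exp3_pred1 (R : comNzRingType) (s t q : R) k l m :
  s ^+ k * t ^+ l * q ^+ m *+ k = s * (s ^+ k.-1 * t ^+ l * q ^+ m *+ k).
Proof. by case: k => [|k]; rewrite ?mulr0n ?mulr0 //= mulrnAr exprS !mulrA. Qed.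

Lemma exp3_pred2 (R : comNzRingType) (s t q : R) k l m :
  s ^+ k * t ^+ l * q ^+ m *+ l = t * (s ^+ k * t ^+ l.-1 * q ^+ m *+ l).
Proof.
by case: l => [|l]; rewrite ?mulr0n ?mulr0 //= mulrnAr exprS !mulrA [s ^+ k * t]mulrC.
Qed.

Definition mderivE := (mderivD, mderivN, mderivM, mderivXi).

(** By [phi_unique]. Both $\xi+d\eta$ and $\eta$, with $d$ the third variable, are killed by
    $\eta\partial_\xi-\partial_d$, so the products with [W] on the right vanish in [X_Psi];
    $\partial_d$ supplies those on the left. *)
Lemma Phi_Psi_mon a k l :
  phi k l 0 a = Psi a ((xi + dd * eta) ^+ k * eta ^+ l).
Proof.
pose F k l := Psi a ((xi + dd * eta) ^+ k * eta ^+ l).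
have F0 : F 0%N 0%N = a.
  rewrite /F !expr0 mulr1 -mpolyX0 mjetX !mnmE.
  exact: (jet0 proj).
rewrite -[RHS]/(F k l) -{1}F0; apply: esym.
(* The spare factor [1 ^+ 0] makes [mderiv_exp3] applicable. *)
have F1 k' l' : F k' l' = Psi a ((xi + dd * eta) ^+ k' * eta ^+ l' * 1 ^+ 0).
  by rewrite expr0 mulr1.
move: k l; apply: (phi_unique K0 proj) => // k l; rewrite !F1.
  rewrite Y_Psi // [X in mjet _ X](_ : _ =
    (xi + dd * eta) ^+ k * eta ^+ l.+1 * 1 ^+ 0
    + (xi + dd * eta) ^+ k * eta ^+ l * 1 ^+ 0 *+ k
    - (xi + dd * eta) ^+ k * eta ^+ l * 1 ^+ 0 *+ l).
    by rewrite linearB linearD !linearMn.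
  by rewrite !mderiv_exp3 !mderivE /= exp3_pred1 exp3_pred2 exprS; ring.
rewrite X_Psi // [X in mul (mjet _ X) _](_ : _ = 0); last first.
  by rewrite !mderiv_exp3 !mderivE /=; ring.
rewrite [X in mul W (mjet _ X)](_ : _ =
    (xi + dd * eta) ^+ k.-1 * eta ^+ l.+1 * 1 ^+ 0 *+ k); last first.
  by rewrite !mderiv_exp3 !mderivE /= exprS; ring.
rewrite [X in mjet _ X + _ + _](_ : _ =
    (xi + dd * eta) ^+ k.+1 * eta ^+ l * 1 ^+ 0
    - (xi + dd * eta) ^+ k.+1 * eta ^+ l.-1 * 1 ^+ 0 *+ l); last first.
  by rewrite !mderiv_exp3 !mderivE /= exprS; ring.
by rewrite linear0 linear0l addr0 linearB !linearMn.
Qed.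

Lemma iterD_Psi j a f : iter j D (Psi a f) = Psi a (dd ^+ j * f).
Proof. by elim: j => [|j IHj] /=; rewrite ?mul1r // IHj D_Psi // exprS mulrA. Qed.

Definition shear (i : 'I_3) : {mpoly K[3]} :=
  if i == v0 then xi + dd * eta else 'X_i.

Lemma mpolyX3 m : 'X_[m] = xi ^+ m v0 * eta ^+ m v1 * dd ^+ m v2.
Proof.
rewrite mpolyXE_id !big_ord_recl big_ord0 mulr1 mulrA.
by congr ('X_ _ ^+ m _ * 'X_ _ ^+ m _ * 'X_ _ ^+ m _); apply: val_inj.
Qed.

(** The factor 1 gives the shape that [mtens_subst] expects. *)
Lemma Phi_Psi a f : Phi a f = Psi a (msubst shear f * 1).
Proof.
rewrite mulr1; move: f.
apply: (@mpoly_linear_eq K A 3 (Phi a) (Psi a \o msubst shear)) => m /=.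
rewrite mjetX -[jet _ _ _ _ _ _ _]/(iter (m v2) D (phi (m v0) (m v1) 0 a)).
rewrite Phi_Psi_mon iterD_Psi (mpolyX3 m) !rmorphM !rmorphXn /= !msubstX.
by rewrite mulrC.
Qed.

(** * Jets of products and of brackets *)

Local Notation Theta a b := (mtens mul (Phi a) (Phi b)).
Local Notation inl := (@inlm K 3 3).
Local Notation inr := (@inrm K 3 3).
Local Notation "f ^l i" := (f^`M(lshift 3 i)) (at level 2, i at level 1).
Local Notation "f ^r i" := (f^`M(rshift 3 i)) (at level 2, i at level 1).

Lemma mderivM_l (p q : {mpoly K[3]}) i :
  (inl p * inr q)^`M(lshift 3 i) = inl (p^`M(i)) * inr q.
Proof. by rewrite mderivM mderiv_inl mderiv_inl_inr mulr0 addr0. Qed.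

Lemma mderivM_r (p q : {mpoly K[3]}) i :
  (inl p * inr q)^`M(rshift 3 i) = inl p * inr (q^`M(i)).
Proof. by rewrite mderivM mderiv_inr mderiv_inr_inl mul0r add0r. Qed.

Lemma D_Theta a b F : D (Theta a b F) = Theta a b ((inl dd + inr dd) * F).
Proof.
move: F; apply: (@eq_mtens K A 3 3 (D \o Theta a b)
  (Theta a b \o ((inl dd + inr dd) \*o idfun))) => p q /=.
rewrite mtensM (act_mulD proj) !D_Phi // -!mtensM -linearD; congr (mtens _ _ _ _).
by rewrite !inmE; ring_in.
Qed.

Lemma Y_Theta a b F :
  Y (Theta a b F) *+ 2
  = Theta a b (inl eta * F - inl eta * F ^l v1 + inl xi * F ^l v0
               + (inl dd * F ^l v2 + inl dd * F ^l v2)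
             + (inr eta * F - inr eta * F ^r v1 + inr xi * F ^r v0
               + (inr dd * F ^r v2 + inr dd * F ^r v2))).
Proof.
move: F; apply: (@eq_mtens K A 3 3 ((Y \o Theta a b) \+ (Y \o Theta a b))
  (Theta a b \o
   ((inl eta \*o idfun) \- (inl eta \*o mderiv (lshift 3 v1))
     \+ (inl xi \*o mderiv (lshift 3 v0))
     \+ ((inl dd \*o mderiv (lshift 3 v2))
         \+ (inl dd \*o mderiv (lshift 3 v2)))
    \+ ((inr eta \*o idfun) \- (inr eta \*o mderiv (rshift 3 v1))
     \+ (inr xi \*o mderiv (rshift 3 v0))
     \+ ((inr dd \*o mderiv (rshift 3 v2))
         \+ (inr dd \*o mderiv (rshift 3 v2))))))) => p q.
rewrite /= -mulr2n mtensM (act_mulY proj) mulrnDl.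
rewrite -(linearMnl mul) -(linearMnr mul) !Y_Phi //.
rewrite -!mtensM -linearD !mderivM_l !mderivM_r; congr (mtens _ _ _ _).
by rewrite !inmE; ring_in.
Qed.

(* The third term collects the products with [W] in the middle; it vanishes on
   the polynomials of [mderiv_symp3]. *)
Lemma X_Theta a b F :
  X (Theta a b F)
  = Theta a b (inl xi * F - inl xi * F ^l v1 + inl dd * (inl dd * F ^l v2)
             + (inr xi * F - inr xi * F ^r v1 + inr dd * (inr dd * F ^r v2))
             + inl dd * (inr eta * F - inr eta * F ^r v1 + inr xi * F ^r v0
                         + (inr dd * F ^r v2 + inr dd * F ^r v2)))
    + mul W (Theta a b (inl eta * F ^l v0 + F ^l v2))
    + mtens mul (Phi a) (mul W \o Phi b) (inr eta * F ^r v0 + F ^r v2 - F ^l v2)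
    - mul (Theta a b (F ^r v2)) W.
Proof.
move: F; apply: (@eq_mtens K A 3 3 (X \o Theta a b)
  ((Theta a b \o
     ((inl xi \*o idfun) \- (inl xi \*o mderiv (lshift 3 v1))
       \+ (inl dd \*o (inl dd \*o mderiv (lshift 3 v2)))
      \+ ((inr xi \*o idfun) \- (inr xi \*o mderiv (rshift 3 v1))
       \+ (inr dd \*o (inr dd \*o mderiv (rshift 3 v2))))
      \+ (inl dd \*o
        ((inr eta \*o idfun) \- (inr eta \*o mderiv (rshift 3 v1))
     \+ (inr xi \*o mderiv (rshift 3 v0))
     \+ ((inr dd \*o mderiv (rshift 3 v2))
         \+ (inr dd \*o mderiv (rshift 3 v2)))))))
   \+ (mul W \o Theta a b \o
        ((inl eta \*o mderiv (lshift 3 v0)) \+ mderiv (lshift 3 v2)))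
   \+ (mtens mul (Phi a) (mul W \o Phi b) \o
        ((inr eta \*o mderiv (rshift 3 v0)) \+ mderiv (rshift 3 v2)
          \- mderiv (lshift 3 v2)))
   \- (applyr mul W \o Theta a b \o mderiv (rshift 3 v2)))) => p q.
rewrite /= !mtensM.
rewrite (act_mulX K0 proj) // (linearMnl mul) -(linearMnr mul).
rewrite !X_Phi // Y_Phi // D_Phi //.
rewrite (linearBl mul) (linearDl mul) (linearBr mul) (linearDr mul).
rewrite -[mul (mul W _) _]mulA -[mul (mul _ W) _]mulA.
rewrite !mderivM_l !mderivM_r.
set T := mtens mul (Phi a) (mul W \o Phi b).
have T1 f g : mul (Phi a f) (mul W (Phi b g)) = T (inl f * inr g) by rewrite /T mtensM.
rewrite !T1 [mul _ (mul _ W)]mulA -!mtensM.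
rewrite [X in _ = Theta a b X + _ + _ - _](_ : _ =
   inl (xi * p - xi * p^`M(v1) + dd * (dd * p^`M(v2))) * inr q
   + inl p * inr (xi * q - xi * q^`M(v1) + dd * (dd * q^`M(v2)))
   + inl (dd * p)
     * inr (eta * q - eta * q^`M(v1) + xi * q^`M(v0) + dd * q^`M(v2) *+ 2));
  last first.
  by rewrite !inmE; ring_in.
rewrite [X in _ = _ + mul W (mtens mul _ _ X) + _ - _](_ : _ =
   inl (eta * p^`M(v0) + p^`M(v2)) * inr q); last first.
  by rewrite !inmE; ring_in.
rewrite [X in _ = _ + T X - _](_ : _ =
   inl p * inr (eta * q^`M(v0) + q^`M(v2)) - inl p^`M(v2) * inr q); last first.
  by rewrite !inmE; ring_in.
rewrite /T linearB !linearD /=.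
by lmodule K A.
Qed.

Lemma mderiv_inlX_l i j : (inl 'X_j)^`M(lshift 3 i) = (i == j)%:R.
Proof. by rewrite mderiv_inl mderivXi rmorph_nat. Qed.
Lemma mderiv_inrX_l i j : (inr 'X_j)^`M(lshift 3 i) = 0.
Proof. exact: mderiv_inl_inr. Qed.
Lemma mderiv_inlX_r i j : (inl 'X_j)^`M(rshift 3 i) = 0.
Proof. exact: mderiv_inr_inl. Qed.
Lemma mderiv_inrX_r i j : (inr 'X_j)^`M(rshift 3 i) = (i == j)%:R.
Proof. by rewrite mderiv_inr mderivXi rmorph_nat. Qed.

(** [sumX], [sumY], [sumD] are the symbols of the coproducts of $X$, $2Y$ and $\delta_1/2$; the last
    term of [sumX] is $\delta_1\otimes Y$ read as $\delta_1/2\otimes2Y$. *)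
Definition sumX : {mpoly K[3 + 3]} := inl xi + inr xi + inl dd * inr eta.
Definition sumY : {mpoly K[3 + 3]} := inl eta + inr eta.
Definition sumD : {mpoly K[3 + 3]} := inl dd + inr dd.
(* The symplectic form on the plane, after the shear of the second factor. *)
Definition symp : {mpoly K[3 + 3]} :=
  inl eta * inr xi - inl xi * inr eta + inl dd * inl eta * inr eta.

(** The chain rule, [Fx], [Fy], [Fq] being the partial derivatives along [sumX], [sumY], [symp]. *)
Lemma mderiv_symp3 k l m :
  let F := sumX ^+ k * sumY ^+ l * symp ^+ m in
  let Fx := sumX ^+ k.-1 * sumY ^+ l * symp ^+ m *+ k in
  let Fy := sumX ^+ k * sumY ^+ l.-1 * symp ^+ m *+ l in
  let Fq := sumX ^+ k * sumY ^+ l * symp ^+ m.-1 *+ m in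
  (F ^l v0 = Fx - Fq * inr eta) *
  (F ^l v1 = Fy + Fq * (inr xi + inl dd * inr eta)) *
  (F ^l v2 = (Fx + Fq * inl eta) * inr eta) *
  (F ^r v0 = Fx + Fq * inl eta) *
  (F ^r v1 = Fx * inl dd + Fy + Fq * (inl dd * inl eta - inl xi)) *
  (F ^r v2 = 0).
Proof.
move=> F Fx Fy Fq.
have dF i : F^`M(i) = Fx * sumX^`M(i) + Fy * sumY^`M(i) + Fq * symp^`M(i).
  exact: mderiv_exp3.
clearbody F Fx Fy Fq.
have sX i : sumX^`M(i) = (inl xi)^`M(i) + (inr xi)^`M(i)
    + ((inl dd)^`M(i) * inr eta + inl dd * (inr eta)^`M(i)).
  by rewrite /sumX !mderivD mderivM.
have sY i : sumY^`M(i) = (inl eta)^`M(i) + (inr eta)^`M(i) by rewrite mderivD.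
have dsymp i : symp^`M(i) = (inl eta)^`M(i) * inr xi + inl eta * (inr xi)^`M(i)
   - ((inl xi)^`M(i) * inr eta + inl xi * (inr eta)^`M(i))
   + (((inl dd)^`M(i) * inl eta + inl dd * (inl eta)^`M(i)) * inr eta
     + inl dd * inl eta * (inr eta)^`M(i)).
  by rewrite /symp mderivD mderivB !mderivM.
have dl i : F^`M(lshift 3 i)
    = Fx * ((i == v0)%:R + (i == v2)%:R * inr eta) + Fy * (i == v1)%:R
      + Fq * ((i == v1)%:R * inr xi - (i == v0)%:R * inr eta
              + ((i == v2)%:R * inl eta + inl dd * (i == v1)%:R) * inr eta).
  rewrite dF sX sY dsymp !mderiv_inlX_l !mderiv_inrX_l.
  by ring_in.
have dr i : F^`M(rshift 3 i)
    = Fx * ((i == v0)%:R + inl dd * (i == v1)%:R) + Fy * (i == v1)%:R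
      + Fq * (inl eta * (i == v0)%:R - inl xi * (i == v1)%:R
              + inl dd * inl eta * (i == v1)%:R).
  rewrite dF sX sY dsymp !mderiv_inlX_r !mderiv_inrX_r.
  by ring_in.
by do !split; [rewrite dl|rewrite dl|rewrite dl|rewrite dr|rewrite dr|rewrite dr];
  rewrite /=; ring_in.
Qed.

(** By [phi_unique]: all derivations in [Y_Theta] and [X_Theta] kill [symp], so its power is carried
    along while [sumX] and [sumY] behave like [xi] and [eta]. *)
Lemma Theta_mon a b m k l :
  Theta a b (sumX ^+ k * sumY ^+ l * symp ^+ m)
  = phi k l 0 (Theta a b (symp ^+ m)).
Proof.
pose F k l := Theta a b (sumX ^+ k * sumY ^+ l * symp ^+ m).
have F0 : F 0%N 0%N = Theta a b (symp ^+ m) by rewrite /F !expr0 !mul1r.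
rewrite -[LHS]/(F k l) -F0.
move: k l; apply: (phi_unique K0 proj) => // k l; rewrite /F.
  rewrite Y_Theta // [X in mtens _ _ _ X](_ : _ =
    sumX ^+ k * sumY ^+ l.+1 * symp ^+ m
    + sumX ^+ k * sumY ^+ l * symp ^+ m *+ k
    - sumX ^+ k * sumY ^+ l * symp ^+ m *+ l).
    by rewrite linearB linearD !linearMn.
  rewrite !mderiv_symp3 exp3_pred1 exp3_pred2 exprS.
  move: (sumX ^+ k.-1 * sumY ^+ l * symp ^+ m *+ k)
    (sumX ^+ k * sumY ^+ l.-1 * symp ^+ m *+ l)
    (sumX ^+ k * sumY ^+ l * symp ^+ m.-1 *+ m) (sumX ^+ k) (sumY ^+ l) (symp ^+ m).
  by rewrite /sumX /sumY => *; ring_in.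
(* No product keeps [W] in the middle: $\eta_r\partial_{\xi_r}+\partial_{d_r}-\partial_{d_l}$ kills
   [sumX], [sumY] and [symp]. *)
rewrite X_Theta // [X in mtens _ _ (mul W \o _) X](_ : _ = 0); last first.
  by rewrite !mderiv_symp3; ring_in.
rewrite [X in _ + mul W (mtens mul _ _ X) + _ - _](_ : _ =
    sumX ^+ k.-1 * sumY ^+ l.+1 * symp ^+ m *+ k); last first.
  rewrite !mderiv_symp3 exprS.
  move: (sumX ^+ k * sumY ^+ l * symp ^+ m.-1 *+ m).
  move: (sumX ^+ k.-1) (sumY ^+ l) (symp ^+ m).
  by rewrite /sumY => *; ring_in.
rewrite [X in Theta a b X + _ + _ - _](_ : _ =
    sumX ^+ k.+1 * sumY ^+ l * symp ^+ m
    - sumX ^+ k.+1 * sumY ^+ l.-1 * symp ^+ m *+ l); last first.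
  rewrite !mderiv_symp3 exprS.
  move: (sumX ^+ k * sumY ^+ l * symp ^+ m.-1 *+ m).
  move: (sumX ^+ k.-1 * sumY ^+ l * symp ^+ m *+ k).
  move: (sumX ^+ k) (sumY ^+ l) (sumY ^+ l.-1) (symp ^+ m).
  by rewrite /sumX => *; ring_in.
rewrite !mderiv_symp3 !linear0 linear0l addr0 subr0.
by rewrite linearB !linearMn.
Qed.

Lemma iterD_Theta j a b F : iter j D (Theta a b F) = Theta a b (sumD ^+ j * F).
Proof.
elim: j => [|j IHj] /=; first by rewrite mul1r.
by rewrite IHj D_Theta // exprS mulrA.
Qed.

Definition diag (i : 'I_3) : {mpoly K[3 + 3]} :=
  if i == v0 then sumX else if i == v1 then sumY else sumD.

(** [Theta_mon] with powers of [D] added; as a derivation of [mul], [D] multiplies by [sumD]. *)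
Lemma Phi_Theta a b m f :
  Phi (Theta a b (symp ^+ m)) f = Theta a b (msubst diag f * symp ^+ m).
Proof.
move: f; apply: (@mpoly_linear_eq K A 3 (Phi (Theta a b (symp ^+ m)))
  (Theta a b \o ((symp ^+ m) \o* msubst diag))) => k.
rewrite /= mjetX.
rewrite -[jet _ _ _ _ _ _ _]/(iter (k v2) D
  (phi (k v0) (k v1) 0 (Theta a b (symp ^+ m)))).
rewrite -Theta_mon // iterD_Theta (mpolyX3 k) !rmorphM !rmorphXn /= !msubstX /=.
by rewrite mulrA; congr (mtens _ _ _ (_ * _)); rewrite mulrC.
Qed.

(** Shearing the first factor cancels the cubic term of [symp]. *)
Lemma Theta_sheared a b n :
  Theta a b (symp ^+ n)
  = mtens mul (Psi a) (Phi b) ((inl eta * inr xi - inl xi * inr eta) ^+ n).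
Proof.
have PP f : Phi a f = Psi a (msubst shear f * 1) by apply: Phi_Psi.
have QQ f : Phi b f = Phi b (msubst (fun i => 'X_i) f * 1).
  by rewrite msubst_id mulr1.
rewrite (mtens_subst mul PP QQ) !rmorph1 !mulr1 rmorphXn /=.
congr (mtens _ _ _ (_ ^+ n)).
rewrite /symp !msubstE !msubstX /shear /= !inmE.
by ring_in.
Qed.

(** * Brackets as powers of the symplectic form, and their associativity *)

Lemma fact_neq0 n : (n`!)%:R != 0 :> K.
Proof. by rewrite (iffLR (pcharf0P K) K0) -lt0n fact_gt0. Qed.

(** The binomial expansion of [Theta_sheared]: its sign $(-1)^k$ is the one in [opAE], and the
    exponents of [eta] give the Pochhammer factors. *)
Lemma bracketE n a b :
  rc_bracket mul act Omega n a b = (n`!)%:R^-1 *: Theta a b (symp ^+ n).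
Proof.
rewrite Theta_sheared exprBn [mtens mul _ _ _]linear_sum scaler_sumr.
apply: eq_bigr => k _; have le_kn : (k <= n)%N by rewrite -ltnS.
have -> : (-1) ^+ k * (inl eta * inr xi) ^+ (n - k) * (inl xi * inr eta) ^+ k
    = (-1) ^+ k *: (inl (xi ^+ k * eta ^+ (n - k) * dd ^+ 0)
                    * inr (xi ^+ (n - k) * eta ^+ k * dd ^+ 0)).
  rewrite -[in LHS]signr_odd -[in RHS]signr_odd scaler_sign -mulr_sign.
  by rewrite !expr0 !mulr1 !inmE !rmorphXn !exprMn /=; ring_in.
rewrite /= [mtens mul _ _ _]linearMn /= [mtens mul _ _ _]linearZ_LR /=.
rewrite mtensM /= !mjet_mon linearZl_LR linearZr_LR (opAE K0 proj) linearZl_LR.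
rewrite -[opB _ _ _ _ _]/(phi (n - k) k 0 b).
rewrite -[rc_op _ _ _ _ _]/(psi k (n - k) 0 a).
rewrite -scaler_nat !scalerA; congr (_ *: _).
(* The binomial coefficient over [n!] is the product of the inverses of [k!] and [(n - k)!]. *)
rewrite -(bin_fact le_kn) !natrM.
have bin_neq0 : 'C(n, k)%:R != 0 :> K.
  by rewrite (iffLR (pcharf0P K) K0) -lt0n bin_gt0.
by field; rewrite bin_neq0 !fact_neq0.
Qed.

(** Symbols of the coproduct applied to the second tensor factor, and in [diagL] to the first; they
    express the outer [symp] in the variables of the inner arguments. *)
Definition diagR (i : 'I_(3 + 3)) : {mpoly K[3 + (3 + 3)]} :=
  msplit (fun i => inlm (3 + 3) 'X_i) (fun i => inrm 3 (diag i)) i.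
Definition diagL (i : 'I_(3 + 3)) : {mpoly K[3 + 3 + 3]} :=
  msplit (fun i => inlm 3 (diag i)) (fun i => inrm (3 + 3) 'X_i) i.

Lemma Theta_ThetaR a b c m n :
  Theta a (Theta b c (symp ^+ m)) (symp ^+ n)
  = mtens mul (Phi a) (Theta b c)
      (msubst diagR symp ^+ n * inrm 3 symp ^+ m).
Proof.
have PP f : Phi a f = Phi a (msubst (fun i => 'X_i) f * 1).
  by rewrite msubst_id mulr1.
rewrite (mtens_subst mul PP (Phi_Theta b c m)) rmorph1 mul1r !rmorphXn /=.
by [].
Qed.

Lemma Theta_ThetaL a b c m n :
  Theta (Theta a b (symp ^+ m)) c (symp ^+ n)
  = mtens mul (Theta a b) (Phi c)
      (msubst diagL symp ^+ n * inlm 3 symp ^+ m).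
Proof.
have PP f : Phi c f = Phi c (msubst (fun i => 'X_i) f * 1).
  by rewrite msubst_id mulr1.
rewrite (mtens_subst mul (Phi_Theta a b m) PP) rmorph1 mulr1 !rmorphXn /=.
by [].
Qed.

(* Both sides are the sum of the symplectic forms of the three pairs of
   factors, suitably sheared. *)
Lemma symp_assoc :
  massoc (msubst diagL symp) + massoc (inlm 3 symp)
  = msubst diagR symp + inrm 3 symp :> {mpoly K[3 + (3 + 3)]}.
Proof.
rewrite {1 3}/symp /diagL /diagR !msubstE !msubstX /diag /=.
by rewrite /symp /sumX /sumY /sumD !inmE !massocE; ring_in.
Qed.

(** The binomial theorem for divided powers. *)
Lemma sum_exp_fact (R : comAlgType K) (T : {linear R -> A}) (x y : R) N :
  \sum_(m < N.+1) (m`!)%:R^-1 *: (((N - m)`!)%:R^-1 *: T (x ^+ (N - m) * y ^+ m))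
  = (N`!)%:R^-1 *: T ((x + y) ^+ N).
Proof.
rewrite exprDn linear_sum scaler_sumr; apply: eq_bigr => m _.
have le_mN : (m <= N)%N by rewrite -ltnS.
rewrite linearMn /= -scaler_nat !scalerA; congr (_ *: _).
rewrite -(bin_fact le_mN) !natrM.
have bin_neq0 : 'C(N, m)%:R != 0 :> K.
  by rewrite (iffLR (pcharf0P K) K0) -lt0n bin_gt0.
by field; rewrite bin_neq0 !fact_neq0.
Qed.

Lemma opA_linear m : linear (opA mul act Omega m).
Proof. by move=> c a b; rewrite !(opAE K0 proj) linearP /=; lmodule K A. Qed.

Lemma opB_linear m : linear (opB mul act Omega m).
Proof. exact: (rc_op_linear act (act (hX K)) (mul Omega)). Qed.

Lemma rc_bracket_linearl n b : linear (fun a => rc_bracket mul act Omega n a b).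
Proof.
move=> c a a'; rewrite /rc_bracket scaler_sumr -big_split; apply: eq_bigr => k _.
rewrite linearPr opA_linear /= -linearZl_LR -linearDl; congr (mul _ _).
by lmodule K A.
Qed.

Lemma rc_bracket_linearr n a : linear (rc_bracket mul act Omega n a).
Proof.
move=> c b b'; rewrite /rc_bracket scaler_sumr -big_split; apply: eq_bigr => k _.
rewrite linearPr opB_linear /= -linearZr_LR -linearDr; congr (mul _ _).
by lmodule K A.
Qed.

(** By [sum_exp_fact] each side is a divided [N]-th power evaluated on the jets of [a], [b], [c];
    the bases agree by [symp_assoc]. *)
Lemma rc_bracket_assoc N a b c :
  \sum_(m < N.+1) rc_bracket mul act Omega (N - m) a
      (rc_bracket mul act Omega m b c)
  = \sum_(m < N.+1) rc_bracket mul act Omega (N - m)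
      (rc_bracket mul act Omega m a b) c.
Proof.
have scale_r n x s u : rc_bracket mul act Omega n x (s *: u)
    = s *: rc_bracket mul act Omega n x u.
  by have := scalable_linear (rc_bracket_linearr n x) s u.
have scale_l n x s u : rc_bracket mul act Omega n (s *: u) x
    = s *: rc_bracket mul act Omega n u x.
  by have := scalable_linear (rc_bracket_linearl n x) s u.
under eq_bigr do rewrite [rc_bracket _ _ _ _ b c]bracketE scale_r bracketE Theta_ThetaR.
under [RHS]eq_bigr do rewrite [rc_bracket _ _ _ _ a b]bracketE scale_l bracketE
  Theta_ThetaL mtensA // rmorphM !rmorphXn /=.
rewrite (sum_exp_fact (mtens mul (Phi a) (Theta b c))).
rewrite (sum_exp_fact (mtens mul (Phi a) (Theta b c))).
by rewrite symp_assoc.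
Qed.

End Functionals.

(** * The star product on formal series *)

Lemma gstar_hconst (K : fieldType) (A : lmodType K) (br : nat -> A -> A -> A)
    (br_addl : forall n b, {morph br n ^~ b : a a' / a + a'})
    (br_addr : forall n a, {morph br n a : b b' / b + b'}) (a b : A) :
  gstar br (hconst a) (hconst b) = br ^~ a ^~ b.
Proof.
apply/funext => n; rewrite /gstar big_ord_recl [X in _ + X]big1 ?addr0; last first.
  by move=> i _; apply: big1 => j _; rewrite /hconst /= (br0l br_addl).
rewrite big_mkcond big_ord_recl /= [X in _ + X]big1 ?addr0 ?subn0 // => j _.
by rewrite /hconst /= (br0r br_addr) if_same.
Qed.

Theorem mainTheorem2 (R : realType) (A : lmodType R[i])
    (mul : {bilinear A -> A -> A}) (mulA : associative mul)
    (act : {bilinear H1 R[i] -> A -> A}) (Omega : A)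
    (proj : H1_projective mul act Omega)
    (YOmega : act (hY R[i]) Omega = 2%:R *: Omega) :
  [/\ hbilinear (rc_star mul act Omega),
      forall a b : A,
        rc_star mul act Omega (hconst a) (hconst b)
        = rc_series mul act Omega a b &
      associative (rc_star mul act Omega)].
Proof.
have K0 : [pchar R[i]] =i pred0 by exact: Num.Theory.pchar_num.
pose br := rc_bracket mul act Omega.
have linl n b : linear (br n ^~ b) by apply: rc_bracket_linearl K0 proj n b.
have linr n a : linear (br n a) by apply: rc_bracket_linearr n a.
have addl n b : {morph br n ^~ b : a a' / a + a'}.
  by move=> a a'; have := linl n b 1 a a'; rewrite !scale1r.
have addr n a : {morph br n a : b b' / b + b'}.
  by move=> b b'; have := linr n a 1 b b'; rewrite !scale1r.
(* From here on only the bilinearity of the brackets and [rc_bracket_assoc] are used. *)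
rewrite -[rc_star _ _ _]/(gstar br); split.
- split=> [f f' g|f g g'|c f g|c f g].
  + exact: gstar_addl.
  + exact: gstar_addr.
  + exact: gstar_scalel.
  + exact: gstar_scaler.
- by move=> a b; rewrite gstar_hconst.
- by apply: gstarA => // N a b c; apply: rc_bracket_assoc.
Qed.
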